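(* Let $\Delta$ be a locally compact Hausdorff space with countable base, $\{a_n\}$ positive with $a_n\to\infty$, and $\{\xi^n\}_{n\in\mathbb{N}}$ an $\mathcal{M}(\Delta)$-valued process. Assume that for all $m\in\mathbb{N}$ and $f_1,\dots,f_m\in C_c(\Delta)$, the $\mathbb{R}^m$-valued process $\{(\xi^nf_1,\dots,\xi^nf_m)\}_n$ satisfies an LDP with speed $a_n$ and good rate function $I_{f_1,\dots,f_m}$. Then $\{\xi^n\}$ satisfies the LDP in $\mathcal{M}(\Delta)$ with speed $a_n$ and good rate function \[ I(\xi)=\sup_{m\in\mathbb{N}}\sup_{f_1,\dots,f_m\in C_c(\Delta)}I_{f_1,\dots,f_m}(\xi f_1,\dots,\xi f_m). \] Moreover: (1) if $I_f$ has a unique zero for every $f\in C_c(\Delta)$, then $I$ has a unique zero; (2) if every $I_{f_1,\dots,f_m}$ is convex and $\sup_n a_n^{-1}\log\mathbb{E}[\exp(a_n\xi^nf)]<\infty$ for every $f\in C_c(\Delta)$, then for every $f\in C_c(\Delta)$ the limit $\varphi(f)=\lim_{n\to\infty}a_n^{-1}\log\mathbb{E}[\exp(a_n\xi^nf)]$ exists in $\mathbb{R}$ and $I(\xi)=\sup_{f\in C_c(\Delta)}\{\xi f-\varphi(f)\}$ for all $\xi\in\mathcal{M}(\Delta)$.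
   Context: $C_c(\Delta)$: real continuous compactly supported functions on $\Delta$. $\mathcal{M}(\Delta)$: Radon measures on $\Delta$ (Borel measures finite on compact sets), with the vague topology, i.e. the weakest topology making $\xi\mapsto\xi f:=\int_\Delta f\,d\xi$ continuous for every $f\in C_c(\Delta)$. LDP with speed $a_n$ and rate function $I$ (lower semicontinuous, $[0,\infty]$-valued): $\limsup a_n^{-1}\log P(\xi^n\in F)\le-\inf_F I$ for closed $F$ and $\liminf a_n^{-1}\log P(\xi^n\in G)\ge-\inf_G I$ for open $G$; good means all sublevel sets $\{I\le\alpha\}$ are compact. *)

(* Defs.v *)
From HB Require Import structures.
From mathcomp Require Import all_boot all_order all_algebra.
From mathcomp Require Import all_classical all_reals all_analysis.
Set Implicit Arguments. Unset Strict Implicit. Unset Printing Implicit Defensive.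
Import Order.TTheory GRing.Theory Num.Theory.
Import numFieldNormedType.Exports.
Local Open Scope classical_set_scope.
Local Open Scope ring_scope.

Definition borelT (T : ptopologicalType) := g_sigma_algebraType (@open T).

Definition Cc (R : realType) (T : ptopologicalType) (f : T -> R) : Prop :=
  continuous f /\ compact (closure [set x | f x != 0]).

Record radon (R : realType) (T : ptopologicalType) := Radon {
  rmeas :> {measure set (borelT T) -> \bar R} ;
  rmeas_fin : forall K : set T, compact K -> (rmeas K < +oo)%E }.

Definition rint (R : realType) (T : ptopologicalType) (xi : radon R T) (f : T -> R) : R :=
  fine (\int[xi]_x (f x)%:E)%E.

(* agreement of two measures on all Borel sets (measures as set functions are
   only meaningful on measurable sets) *)
Definition meq (R : realType) (T : ptopologicalType) (xi eta : radon R T) : Prop :=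
  forall A : set (borelT T), measurable A -> xi A = eta A.

(* open sets of the vague topology on M(Delta): the initial topology of the maps
   xi |-> xi f, f in C_c; written out via its standard basic neighbourhoods *)
Definition vague_open (R : realType) (T : ptopologicalType) (G : set (radon R T)) : Prop :=
  forall xi, G xi -> exists (m : nat) (fs : 'I_m -> T -> R) (e : R),
    [/\ (forall i, Cc (fs i)), 0 < e &
      [set eta | forall i, `|rint eta (fs i) - rint xi (fs i)| < e] `<=` G].

Definition compact_wrt (T : Type) (opn : set T -> Prop) (K : set T) : Prop :=
  forall C : set (set T), (forall U, C U -> opn U) -> K `<=` \bigcup_(U in C) U ->
    exists2 D : set (set T), finite_set D & D `<=` C /\ K `<=` \bigcup_(U in D) U.

Definition good_rate (R : realType) (T : Type) (opn : set T -> Prop) (I : T -> \bar R) : Prop :=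
  [/\ forall x, (0 <= I x)%E,
      forall al : R, opn (~` [set x | (I x <= al%:E)%E]) &
      forall al : R, compact_wrt opn [set x | (I x <= al%:E)%E]].

Definition elog (R : realType) (x : \bar R) : \bar R :=
  if x == 0%E then -oo%E else if x == +oo%E then +oo%E else (ln (fine x))%:E.

Definition LDP (R : realType) (d : measure_display) (Om : measurableType d)
  (P : probability Om R) (T : Type) (opn : set T -> Prop)
  (X : nat -> Om -> T) (a : nat -> R) (I : T -> \bar R) : Prop :=
  (forall F : set T, opn (~` F) ->
     (limn_esup (fun n => ((a n)^-1)%:E * elog (P (X n @^-1` F))) <=
       - ereal_inf (I @` F))%E) /\
  (forall G : set T, opn G ->
     (- ereal_inf (I @` G) <=
       limn_einf (fun n => ((a n)^-1)%:E * elog (P (X n @^-1` G))))%E).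

Definition econvex (R : realType) (m : nat) (I : 'rV[R]_m -> \bar R) : Prop :=
  forall (x y : 'rV[R]_m) (t : R), 0 <= t <= 1 ->
    (I (t *: x + (1 - t) *: y)%R <= t%:E * I x + (1 - t)%:E * I y)%E.

Definition vague_rate (R : realType) (T : ptopologicalType)
  (Ifam : forall m : nat, ('I_m -> T -> R) -> 'rV[R]_m -> \bar R) (xi : radon R T) : \bar R :=
  ereal_sup [set y | exists (m : nat) (fs : 'I_m -> T -> R),
     [/\ (0 < m)%N, (forall i, Cc (fs i)) & y = Ifam m fs (\row_i rint xi (fs i))]].

(* Main.v *)
(* Any positive linear functional on C_c is integration against a Radon measure
   (Riesz), so an ultrafilter on M(Delta) along which every [xi f] stays bounded
   has a vague limit. This gives compactness of the level sets of the supremum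
   rate function [I]. For the upper bound on a closed set [A] with
   [al < inf_A I], the same compactness shows that for some finite family [fs]
   the image of [A] stays away from the level set [I_fs <= al], and the
   finite-dimensional upper bound applies to the complement of a neighbourhood
   of that level set. Comparing the upper and lower bounds of two LDPs shows
   that rate functions are compatible with continuous maps between the
   finite-dimensional marginals.

   For the Legendre formula, [phi f] is the Varadhan limit
   [sup_z (z - I_f z)]. A finite-dimensional convex [I_fs] is recovered from its
   affine minorants, obtained by minimising [I_fs + k |. - y0|^2]; the slope
   [lam] of such a minorant gives the test function [sum_i lam_i fs_i]. *)
Require Import Defs.
From HB Require Import structures.
From mathcomp Require Import all_boot all_order all_algebra.
From mathcomp Require Import all_classical all_reals all_analysis.
From mathcomp Require Import measurable_realfun.
From mathcomp Require Import finmap ring lra.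
Set Implicit Arguments. Unset Strict Implicit. Unset Printing Implicit Defensive.
Import Order.TTheory GRing.Theory Num.Theory.
Import numFieldNormedType.Exports.
Local Open Scope classical_set_scope.
Local Open Scope ring_scope.

(** * Compactly supported continuous functions *)

(** The rate functions of different families are unrelated by assumption. Every link between them
    comes from an inclusion of events [{X_n in G}] in [{Y_n in C}] whose probabilities obey two
    LDPs; this is [LDP_compare]. It yields points that are only approximately mapped where they
    should be, which is enough because lower semicontinuity, or the minimality that characterises
    [phi f], absorbs an arbitrarily small error. Boundedness of [xi f] along an ultrafilter comes
    from families of size one: the level sets of the good rate [I_f] on the line are bounded. Second
    countability acts through [Cc_exhaustion]: the indicator of an open set is an increasing limit
    of a sequence in [C_c]. This gives both the Caratheodory measurability of open sets in the Riesz
    construction and the uniqueness of a Radon measure with given integrals. In the Legendre part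
    the moment bound is used at [2 f] as well as at [f]; the former controls the exponential tail of
    [xi^n f]. *)

Section Cc_theory.
Context {R : realType} {T : ptopologicalType}.
Implicit Types f g h : T -> R.

Lemma Cc_continuous f : Cc f -> continuous f. Proof. by case. Qed.

Lemma Cc_supported f g h : Cc f -> Cc g -> continuous h ->
  [set x | h x != 0] `<=` [set x | f x != 0] `|` [set x | g x != 0] -> Cc h.
Proof.
move=> [_ kf] [_ kg] ch hfg; split => //.
apply: subclosed_compact (compactU kf kg) _; first exact: closed_closure.
by rewrite -closureU; exact: closureS.
Qed.

Lemma Cc_supported1 f h : Cc f -> continuous h ->
  (forall x, f x = 0 -> h x = 0) -> Cc h.
Proof.
move=> Cf ch fh; apply: (Cc_supported Cf Cf ch) => x /= hx; left.
by apply: contra_neq hx; exact: fh.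
Qed.

Lemma Cc0 : Cc (fun _ : T => 0 : R).
Proof.
split; first by move=> x; exact: cst_continuous.
rewrite (_ : [set x | _] = set0) ?closure0; first exact: compact0.
by rewrite -subset0 => x /=; rewrite eqxx.
Qed.

Lemma CcD f g : Cc f -> Cc g -> Cc (fun x => f x + g x).
Proof.
move=> Cf Cg; apply: (Cc_supported Cf Cg).
  by move=> x; apply: continuousD; [exact: Cf.1|exact: Cg.1].
move=> x /= fg0; apply/orP; rewrite -negb_and; apply: contra fg0.
by move=> /andP[/eqP-> /eqP->]; rewrite addr0.
Qed.

Lemma CcMr f g : Cc f -> continuous g -> Cc (fun x => f x * g x).
Proof.
move=> Cf cg; apply: (Cc_supported1 Cf).
  by move=> x; apply: continuousM; [exact: Cf.1|exact: cg].
by move=> x ->; rewrite mul0r.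
Qed.

Lemma CcZ (c : R) f : Cc f -> Cc (fun x => c * f x).
Proof.
move=> Cf; rewrite (_ : (fun _ => _) = (fun x => f x * c)).
  by apply: CcMr => // x; exact: cst_continuous.
by apply/funext => x; rewrite mulrC.
Qed.

Lemma CcN f : Cc f -> Cc (fun x => - f x).
Proof.
by move=> /(CcZ (-1)); under eq_fun do rewrite mulN1r.
Qed.

Lemma CcB f g : Cc f -> Cc g -> Cc (fun x => f x - g x).
Proof. by move=> Cf /CcN; exact: CcD. Qed.

Lemma Cc_sum (I : Type) (s : seq I) (F : I -> T -> R) :
  (forall i, Cc (F i)) -> Cc (fun x => \sum_(i <- s) F i x).
Proof.
move=> CF; elim: s => [|i s IH].
  by under eq_fun do rewrite big_nil; exact: Cc0.
by under eq_fun do rewrite big_cons; exact: CcD.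
Qed.

Lemma min_continuousR (f g : T -> R) : continuous f -> continuous g ->
  continuous (fun x => Num.min (f x) (g x)).
Proof.
move=> cf cg x.
exact: (cvg_comp _ (fun p => Num.min p.1 p.2) (cvg_pair (cf x) (cg x))
  (@min_continuous _ _ (f x, g x))).
Qed.

Lemma max_continuousR (f g : T -> R) : continuous f -> continuous g ->
  continuous (fun x => Num.max (f x) (g x)).
Proof.
move=> cf cg x.
exact: (cvg_comp _ (fun p => Num.max p.1 p.2) (cvg_pair (cf x) (cg x))
  (@max_continuous _ _ (f x, g x))).
Qed.

Lemma Cc_bounded f : Cc f -> exists M : R, 0 < M /\ forall x, `|f x| <= M.
Proof.
move=> [cf kf].
have /continuous_compact : {within closure [set x | f x != 0], continuous f}.
  exact: continuous_subspaceT.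
move=> /(_ kf)/compact_bounded[M [_ Mf]].
exists (`|M| + 1); split; first by rewrite ltr_wpDl.
move=> x; have [->|fx] := eqVneq (f x) 0; first by rewrite normr0 addr_ge0.
apply: Mf; first by rewrite (le_lt_trans (ler_norm _))// ltrDl.
by exists x => //; apply: subset_closure.
Qed.

Hypotheses (Th : hausdorff_space T) (Tl : locally_compact [set: T]).

(** Complete regularity separates [x] from the complement of [U]; cutting [U] down to the interior
    of a compact neighbourhood of [x] beforehand is what makes the support compact. *)
Lemma Cc_bump (U : set T) x : open U -> U x ->
  exists f, [/\ Cc f, forall y, 0 <= f y <= 1, f x = 1 &
    forall y, ~ U y -> f y = 0].
Proof.
move=> oU Ux; have := Tl I; rewrite /= => /(_ x)[V nV [cV clV]].
have nV' : nbhs x V by move: nV; rewrite /within/= => nV; apply: filterS nV => y; exact.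
pose W := U `&` V°.
have oW : open W by apply: openI => //; exact: open_interior.
have Wx : W x by split.
have nWx : ~ (~` W) x by move=> /(_ Wx).
have sep := @locally_compact_completely_regular T R Tl Th x _ (open_closedC oW) nWx.
have [f [cf f01 fx fW]] := (@uniform_separatorP _ R _ _).1 sep.
have f01' y : 0 <= f y <= 1.
  by have := f01 (f y) (ex_intro2 _ _ y I erefl); rewrite /= in_itv.
exists (fun y => 1 - f y); split.
- split; first by move=> y; apply: continuousB; [exact: cst_continuous|exact: cf].
  apply: subclosed_compact cV _; first exact: closed_closure.
  rewrite [X in _ `<=` X](closure_id V).1//; apply: closureS => y /= fy.
  apply: contrapT => nVy.
  have : f y = 1.
    by apply: fW; exists y => //; case=> _ /nbhs_singleton.
  by move=> fy1; move: fy; rewrite fy1 subrr eqxx.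
- by move=> y; have /andP[? ?] := f01' y; rewrite subr_ge0 lerBlDr lerDl; apply/andP.
- by rewrite (fx (f x)) ?subr0//; exists x.
- by move=> y nUy; rewrite (fW (f y)) ?subrr//; exists y => // -[].
Qed.

Lemma Cc_cutoff (K : set T) : compact K ->
  exists h, [/\ Cc h, forall x, 0 <= h x & forall x, K x -> 1 <= h x].
Proof.
rewrite compact_cover => cK.
have /choice[b bP] (x : T) := Cc_bump openT (I : setT x).
pose F x := [set y | 2^-1 < b x y].
have oF x : open (F x).
  rewrite (_ : F x = b x @^-1` [set z | 2^-1 < z]) //.
  by apply: open_comp; [by move=> y _; case: (bP x) => -[+ _] _ _ _; exact|exact: open_gt].
have [|D _ DK] := cK T K F (fun i _ => oF i).
  move=> x Kx; exists x => //; rewrite /F /=; case: (bP x) => _ _ -> _.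
  by rewrite invf_lt1 // ltr1n.
(* The cover uses the sets where a bump exceeds 1/2, so doubling makes one summand at least 1 at
   each point of [K]. *)
exists (fun y => \sum_(x <- D) 2 * b x y); split.
- by apply: Cc_sum => x; apply: CcZ; case: (bP x).
- move=> y; apply: sumr_ge0 => x _; apply: mulr_ge0 => //.
  by case: (bP x) => _ /(_ y)/andP[].
- move=> y /DK[x /= xD Fy]; rewrite (big_rem x)//=.
  have : 1 <= 2 * b x y by move: Fy; rewrite /F/=; lra.
  move/le_trans; apply; rewrite lerDl; apply: sumr_ge0 => z _.
  by apply: mulr_ge0 => //; case: (bP z) => _ /(_ y)/andP[].
Qed.

Hypothesis Ts : @second_countable T.

(** Each basic open set that admits a nonnegative [C_c] function positive on it and vanishing off
    [U] contributes one such function. Bumps show that these basic sets cover [U], so the partial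
    sums [s n] are eventually positive at every point of [U]. *)
Lemma Cc_exhaustion (U : set T) : open U -> exists phi : nat -> T -> R,
  [/\ forall n, Cc (phi n), forall n x, 0 <= phi n x <= 1,
      forall x, nondecreasing_seq (phi ^~ x),
      forall n x, ~ U x -> phi n x = 0 &
      forall x, U x -> exists n, forall m, (n <= m)%N -> phi m x = 1].
Proof.
move=> oU; have [B /pcard_leP/unsquash i [Bo Bb]] := Ts.
(* The last clause is conditional so that a function can be chosen for every index: [0] serves when
   no suitable function exists. *)
pose P n f := [/\ Cc f, forall x, 0 <= f x, forall x, ~ U x -> f x = 0 &
  (exists V g, [/\ B V, i V = n, Cc g, (forall x, 0 <= g x /\ (~ U x -> g x = 0)) &
     V `<=` [set x | 0 < g x]]) ->
   exists V, [/\ B V, i V = n & V `<=` [set x | 0 < f x]]].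
have [g gP] : {g : nat -> T -> R & forall n, P n (g n)}.
  apply: (@choice _ _ P) => n.
  have [[V [g [BV iV Cg gU Vg]]]|no] := pselect (exists V g,
    [/\ B V, i V = n, Cc g, (forall x, 0 <= g x /\ (~ U x -> g x = 0)) &
     V `<=` [set x | 0 < g x]]).
    exists g; split => //; [by move=> x; have [] := gU x|by move=> x; have [] := gU x|].
    by move=> _; exists V.
  by exists (fun _ => 0); split => //; exact: Cc0.
pose s n x := \sum_(k <- iota 0 n) g k x.
have s0 n x : 0 <= s n x by apply: sumr_ge0 => k _; case: (gP k).
have smono x m n : (m <= n)%N -> s m x <= s n x.
  move=> mn; rewrite /s -(subnKC mn) iotaD big_cat/= lerDl.
  by apply: sumr_ge0 => k _; case: (gP k).
(* The factor [n] pushes any positive value of [s n x] past 1, where the minimum stops it;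
   monotonicity in [n] is kept. *)
exists (fun n x => Num.min 1 (n%:R * s n x)); split.
- move=> n; apply: (@Cc_supported1 (s n)).
  + by apply: Cc_sum => k; case: (gP k).
  + apply: min_continuousR; first by move=> x; exact: cst_continuous.
    by apply: Cc_continuous; apply: CcZ; apply: Cc_sum => k; case: (gP k).
  + by move=> x ->; rewrite mulr0 min_r.
- by move=> n x; rewrite le_min ler01 mulr_ge0//= ge_min lexx.
- move=> x m n mn; rewrite le_min ge_min lexx /= ge_min.
  by apply/orP; right; apply: ler_pM => //; [rewrite ler_nat|exact: smono].
- move=> n x nUx; rewrite /s big1 ?mulr0 ?min_r// => k _.
  by case: (gP k) => _ _ ->.
- move=> x Ux; have [f [Cf f01 fx fU]] := Cc_bump oU Ux.
  have f0 y : 0 <= f y by case/andP: (f01 y).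
  have : nbhs x [set y | 0 < f y].
    apply: open_nbhs_nbhs; split; last by rewrite /= fx.
    apply: (@open_comp _ _ f [set z | 0 < z]); last exact: open_gt.
    by move=> y _; exact: Cf.1.
  move=> /(Bb x)[V [BV Vx] /= Vf].
  have [V' [BV' iV' V'g]] : exists V', [/\ B V', i V' = i V &
      V' `<=` [set x | 0 < g (i V) x]].
    by case: (gP (i V)) => _ _ _; apply; exists V, f; split => // y; split => //; exact: fU.
  have VV' : V' = V by exact: (@inj _ _ B i _ _ (mem_set BV') (mem_set BV) iV').
  have gx : 0 < g (i V) x by apply: V'g; rewrite VV'.
  pose k := i V.
  have sx : 0 < s k.+1 x.
    rewrite /s -[X in iota _ X]addn1 iotaD big_cat/= big_seq1 add0n.
    by apply: ltr_wpDl gx; exact: s0.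
  exists (maxn k.+1 (Num.truncn (s k.+1 x)^-1).+1) => m.
  rewrite geq_max => /andP[km tm]; apply/min_l.
  have := truncnS_gt (s k.+1 x)^-1 => /ltW ts.
  suff : (s k.+1 x)^-1 * s k.+1 x <= m%:R * s m x by rewrite mulVf ?lt0r_neq0.
apply: ler_pM.
- by rewrite invr_ge0 ltW.
- exact: ltW.
- by rewrite (le_trans ts)// ler_nat.
- exact: smono.
Qed.

End Cc_theory.

(** * Positive functionals and the Riesz representation *)

Section positive_functionals.
Context {R : realType} {T : ptopologicalType}.
Implicit Types f g h : T -> R.

Definition positive_functional (L : (T -> R) -> R) :=
  [/\ forall f g, Cc f -> Cc g -> L (fun x => f x + g x) = L f + L g,
      forall c f, Cc f -> L (fun x => c * f x) = c * L f &
      forall f, Cc f -> (forall x, 0 <= f x) -> 0 <= L f].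

Section laws.
Variables (L : (T -> R) -> R) (posL : positive_functional L).

Lemma pfD f g : Cc f -> Cc g -> L (fun x => f x + g x) = L f + L g.
Proof. by case: posL => + _ _; exact. Qed.

Lemma pfZ c f : Cc f -> L (fun x => c * f x) = c * L f.
Proof. by case: posL => _ + _; exact. Qed.

Lemma pf_ge0 f : Cc f -> (forall x, 0 <= f x) -> 0 <= L f.
Proof. by case: posL => _ _; exact. Qed.

Lemma pf0 : L (fun=> 0) = 0.
Proof.
rewrite -[RHS](mul0r (L (fun=> 0))) -(pfZ _ Cc0).
by congr L; apply/funext => x; rewrite mul0r.
Qed.

Lemma pfB f g : Cc f -> Cc g -> L (fun x => f x - g x) = L f - L g.
Proof.
move=> Cf Cg; rewrite -mulN1r -pfZ// -pfD//; last exact: CcZ.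
by congr L; apply/funext => x; rewrite mulN1r.
Qed.

Lemma pf_le f g : Cc f -> Cc g -> (forall x, f x <= g x) -> L f <= L g.
Proof.
move=> Cf Cg fg; rewrite -subr_ge0 -pfB//; apply: pf_ge0; first exact: CcB.
by move=> x; rewrite subr_ge0.
Qed.

Lemma pf_sum (I : Type) (s : seq I) (F : I -> T -> R) :
  (forall i, Cc (F i)) ->
  L (fun x => \sum_(i <- s) F i x) = \sum_(i <- s) L (F i).
Proof.
move=> CF; elim: s => [|i s IH].
  by under eq_fun do rewrite big_nil; rewrite big_nil pf0.
under eq_fun do rewrite big_cons; rewrite big_cons -IH pfD//; exact: Cc_sum.
Qed.

End laws.

(* If the hypothesis is read with [J1 u <= m A <= J2 v], it says that both
   functionals are squeezed by the same set function on open sets; slicing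
   [f] into horizontal layers of height [d] shifts [J1] against [J2] by one
   layer only. *)
Lemma pf_slice_le (J1 J2 : (T -> R) -> R) :
  hausdorff_space T -> locally_compact [set: T] ->
  positive_functional J1 -> positive_functional J2 ->
  (forall u v A, Cc u -> Cc v -> open A ->
     (forall x, 0 <= u x <= 1) -> (forall x, ~ A x -> u x = 0) ->
     (forall x, 0 <= v x) -> (forall x, A x -> 1 <= v x) -> J1 u <= J2 v) ->
  forall f, Cc f -> (forall x, 0 <= f x) -> J1 f <= J2 f.
Proof.
move=> Th Tl p1 p2 J12 f Cf f0.
have [M [M0 fM]] := Cc_bounded Cf.
have {}fM x : f x <= M by rewrite (le_trans (ler_norm _))// fM.
have [h [Ch h0 hf]] := @Cc_cutoff R T Th Tl _ Cf.2.
have hf' x : f x != 0 -> 1 <= h x by move=> fx; apply: hf; exact: subset_closure.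
suff H n : J1 f <= J2 f + M / n.+1%:R * J1 h.
  apply/ler_addgt0Pr => e e0.
  have [n /= nP] : exists n, M / n.+1%:R * J1 h <= e.
    have h1 : 0 <= M * J1 h / e.
      by rewrite divr_ge0 ?(ltW e0)// mulr_ge0 ?(ltW M0)//; exact: pf_ge0.
    exists (Num.truncn (M * J1 h / e)).
    have := truncnS_gt (M * J1 h / e); rewrite ltr_pdivrMr// => /ltW.
    by move=> h2; rewrite mulrAC ler_pdivrMr ?ltr0n// (mulrC e).
  by rewrite (le_trans (H n))// lerD2l.
pose d := M / n.+1%:R.
have d0 : 0 < d by rewrite divr_gt0.
(* [F i] is the part of [f] between heights [i d] and [(i+1) d]; since [(n+1) d = M] bounds [f], the
   first [n+1] layers sum to [f]. *)
pose F i x := Num.min (f x) (i.+1%:R * d) - Num.min (f x) (i%:R * d).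
have id0 i : 0 <= i%:R * d by rewrite mulr_ge0 ?(ltW d0).
have iSd i : i.+1%:R * d = i%:R * d + d by rewrite -natr1 mulrDl mul1r.
have CF i : Cc (F i).
  apply: (Cc_supported1 Cf).
    by move=> x; apply: (@continuousB _ _ _ (fun x => Num.min (f x) _)
      (fun x => Num.min (f x) _)); apply: min_continuousR => //;
      (try exact: Cf.1) => y; exact: cst_continuous.
  by move=> x fx0; rewrite /F fx0 !min_l ?subrr.
have F0 i x : 0 <= F i x.
  rewrite /F iSd; have := d0; case: (leP (f x) (i%:R * d + d));
  case: (leP (f x) (i%:R * d)); lra.
have Fd i x : F i x <= d.
  rewrite /F iSd; have := d0; case: (leP (f x) (i%:R * d + d));
  case: (leP (f x) (i%:R * d)); lra.
have sumF x : f x = \sum_(i <- index_iota 0 n.+1) F i x.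
  rewrite (telescope_sumr (fun i => Num.min (f x) (i%:R * d)))//.
  by rewrite mul0r (min_r (f0 x)) subr0 min_l// /d mulrC divfK.
have JF (J : (T -> R) -> R) : positive_functional J ->
    J f = \sum_(i <- index_iota 0 n.+1) J (F i).
  by move=> pJ; rewrite -(pf_sum pJ)//; congr J; apply/funext.
have step i : J1 (F i.+1) <= J2 (F i).
  (* This set lies between two consecutive layers: [F i.+1] vanishes off it, and [F i] has its full
     height [d] on it. *)
  pose A := [set x | i.+1%:R * d < f x].
  have oA : open A.
    by apply: (@open_comp _ _ f [set z | _ < z]); [move=> y _; exact: Cf.1|exact: open_gt].
  have := J12 (fun x => d^-1 * F i.+1 x) (fun x => d^-1 * F i x) A.
  rewrite (pfZ p1)// (pfZ p2)// ler_pM2l ?invr_gt0//; apply => //.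
  - exact: CcZ.
  - exact: CcZ.
  - by move=> x; rewrite mulr_ge0 ?invr_ge0 ?(ltW d0)//= mulrC ler_pdivrMr// mul1r.
  - by move=> x /negP; rewrite -leNgt => fx; rewrite /F !min_l ?subrr ?mulr0// (iSd i.+1) ler_wpDr ?(ltW d0).
  - by move=> x; rewrite mulr_ge0 ?invr_ge0 ?(ltW d0).
  - move=> x Ax; have fx : i.+1%:R * d <= f x by exact: ltW.
    rewrite /F (min_r fx) min_r; last by move: fx; rewrite iSd; have := d0; lra.
    by rewrite iSd addrAC subrr add0r mulVf ?gt_eqF.
(* The bottom layer under [J1] is split off and becomes the error, bounded by [d * h]; the remaining
   ones are matched with the layers of [J2] one below, whose top layer is dropped. *)
rewrite (JF _ p1) big_nat_recl//= addrC lerD//.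
  rewrite (JF _ p2) big_nat_recr//= ler_wpDr//; first exact: pf_ge0.
  by apply: ler_sum => i _; exact: step.
rewrite -(pfZ p1)//; apply: pf_le => //; first exact: CcZ.
move=> x; have [fx0|fx] := eqVneq (f x) 0.
  by rewrite /F fx0 !min_l// subrr mulr_ge0 ?(ltW d0).
by rewrite (le_trans (Fd 0%N x))// ler_peMr ?(ltW d0)//; exact: hf'.
Qed.

Variables (Th : hausdorff_space T) (Tl : locally_compact [set: T]).
Variables (L : (T -> R) -> R) (posL : positive_functional L).

(** A Dini argument: the open sets where a partial sum exceeds [f - d] increase and cover the
    compact support of [f], so one partial sum works everywhere. The cutoff [h] turns the uniform
    error [d] into the error [d * L h] after applying [L]. *)
Lemma pf_daniell f (g : nat -> T -> R) : Cc f -> (forall x, 0 <= f x) ->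
  (forall k, Cc (g k)) -> (forall k x, 0 <= g k x) ->
  (forall x, ((f x)%:E <= \sum_(k <oo) (g k x)%:E)%E) ->
  ((L f)%:E <= \sum_(k <oo) (L (g k))%:E)%E.
Proof.
move=> Cf f0 Cg g0 fg; apply/lee_addgt0Pr => e e0.
have [h [Ch h0 hf]] := @Cc_cutoff R T Th Tl _ Cf.2.
have Lh0 : 0 <= L h by exact: pf_ge0.
(* Chosen so that [d * L h <= e]; the [+ 1] covers the case [L h = 0]. *)
pose d := e / (L h + 1).
have d0 : 0 < d by rewrite divr_gt0// ltr_wpDl.
pose F n := [set x | f x - \sum_(0 <= k < n) g k x < d].
have oF n : open (F n).
  apply: (@open_comp _ _ (fun x => f x - _) [set z | z < d]); last exact: open_lt.
  by move=> x _; apply: Cc_continuous; apply: CcB => //; exact: Cc_sum.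
have coverF : closure [set x | f x != 0] `<=` cover [set: nat] F.
  move=> x _; apply: contrapT => nF.
  have : (\sum_(k <oo) (g k x)%:E <= (f x - d)%:E)%E.
    apply: lime_le; first by apply: is_cvg_nneseries => n _ _; rewrite lee_fin.
    apply: nearW => n; rewrite sumEFin lee_fin leNgt; apply/negP => fn.
    by apply: nF; exists n => //; rewrite /F/=; move: fn; lra.
  move/(le_trans (fg x)); rewrite lee_fin; have := d0; lra.
have := Cf.2; rewrite compact_cover => /(_ _ _ _ (fun i _ => oF i) coverF)[D _ DK].
pose N := \max_(i <- enum_fset D) i.
have gmono x m n : (m <= n)%N -> \sum_(0 <= k < m) g k x <= \sum_(0 <= k < n) g k x.
  move=> mn; rewrite (@big_cat_nat _ _ _ m 0 n)//= lerDl.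
  by apply: sumr_ge0.
have fN x : f x <= \sum_(0 <= k < N) g k x + d * h x.
  have [fx0|fx] := eqVneq (f x) 0.
    rewrite fx0; apply: addr_ge0; first by apply: sumr_ge0.
    by apply: mulr_ge0 => //; exact: ltW.
  have cx : closure [set x | f x != 0] x by exact: subset_closure.
  have [i /= iD Fx] := DK _ cx.
  have iN : (i <= N)%N by exact: leq_bigmax_seq.
  have := gmono x _ _ iN; have : d <= d * h x by rewrite ler_peMr ?(ltW d0)//; exact: hf.
  by move: Fx; rewrite /F/=; lra.
have CS : Cc (fun x => \sum_(0 <= k < N) g k x) by exact: Cc_sum.
have : L f <= \sum_(0 <= k < N) L (g k) + e.
  apply: (@le_trans _ _ (L (fun x => \sum_(0 <= k < N) g k x + d * h x))).
    by apply: pf_le => //; apply: CcD => //; exact: CcZ.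
  rewrite pfD//; last exact: CcZ.
  rewrite pf_sum// pfZ// lerD2l /d mulrAC ler_pdivrMr ?ltr_wpDl//.
  by rewrite ler_pM2l// lerDl.
rewrite -lee_fin => /le_trans; apply; rewrite EFinD leeD2r// -sumEFin.
by apply: nneseries_lim_ge => k _ _; rewrite lee_fin pf_ge0.
Qed.

End positive_functionals.

(** * Rearrangement and telescoping of nonnegative series *)

Section series_lemmas.
Context {R : realType}.
Local Open Scope ereal_scope.

(** One enumeration of the pairs has to serve all [h]: it is applied both to the values of the
    covering functions at each point and to their images under [L]. *)
Lemma double_nneseries : exists f : nat -> nat * nat,
  forall h : nat -> nat -> \bar R, (forall n k, 0 <= h n k) ->
  \sum_(i <oo) h (f i).1 (f i).2 = \sum_(n <oo) \sum_(k <oo) h n k.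
Proof.
have /card_esym/card_set_bijP[f bf] := card_nat2.
exists f => h h0; rewrite nneseries_esumT//.
rewrite -(@reindex_esum _ _ _ _ _ _ (fun p => h p.1 p.2) bf).
rewrite nneseries_esumT; last by move=> n; apply: nneseries_ge0.
transitivity (\esum_(i in [set: nat]) \esum_(k in [set: nat]) h i k); last first.
  by apply: eq_esum => i _; rewrite nneseries_esumT.
rewrite (@esum_esum _ _ _ _ (fun=> setT))//; congr esum.
by apply/seteqP; split.
Qed.

Lemma eseries_head (c : \bar R) (F : nat -> \bar R) :
  F 0%N = c -> (forall k, F k.+1 = 0) -> \sum_(k <oo) F k = c.
Proof.
move=> F0 FS; apply/cvg_lim => //; rewrite -cvg_shiftS.
rewrite (_ : [sequence _]_n = cst c); first exact: cvg_cst.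
by apply/funext => n /=; rewrite big_nat_recl//= big1 ?adde0.
Qed.

Lemma nneseries_telescope (u : nat -> R) (c : R) :
  u 0%N = 0%R -> {homo u : m n / (m <= n)%N >-> (m <= n)%R} ->
  (forall n, (u n <= c)%R) -> (forall e, (0 < e)%R -> exists n, (c - e < u n)%R) ->
  \sum_(k <oo) (u k.+1 - u k)%:E = c%:E.
Proof.
move=> u0 um uc ce; apply/eqP; rewrite eq_le; apply/andP; split.
  apply: lime_le.
    by apply: is_cvg_nneseries => n _ _; rewrite lee_fin subr_ge0 um.
  apply: nearW => n; rewrite sumEFin lee_fin telescope_sumr// u0 subr0.
  exact: uc.
apply/lee_addgt0Pr => e e0; have [n un] := ce e e0.
apply: (@le_trans _ _ ((u n)%:E + e%:E)).
  by rewrite -EFinD lee_fin; move: un; lra.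
rewrite leeD2r//; apply: le_trans (nneseries_lim_ge n _).
  by rewrite sumEFin lee_fin telescope_sumr// u0 subr0.
by move=> k _ _; rewrite lee_fin subr_ge0 um.
Qed.

End series_lemmas.

(** * The outer measure of a positive functional *)

Section riesz_outer_measure.
Context {R : realType} {T : ptopologicalType}.
Variables (Th : hausdorff_space T) (Tl : locally_compact [set: T]).
Variables (L : (T -> R) -> R) (posL : positive_functional L).
Local Open Scope ereal_scope.

(* Sets are covered by series of functions, as in Daniell's construction: an
   open set [U] is then Caratheodory measurable because each [g k] splits into
   [g k * phi n] and [g k * (1 - phi n)] with [phi n] increasing to [1] on [U]. *)
Definition Cc_cover (A : set T) (g : nat -> T -> R) :=
  [/\ forall k, Cc (g k), forall k x, (0 <= g k x)%R &
      forall x, A x -> 1 <= \sum_(k <oo) (g k x)%:E].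

Definition riesz_outer (A : set T) : \bar R :=
  ereal_inf [set \sum_(k <oo) (L (g k))%:E | g in Cc_cover A].

Lemma riesz_outer_ge0 A : 0 <= riesz_outer A.
Proof.
apply: le_ereal_inf_tmp => _ [g [Cg g0 _] <-].
by apply: nneseries_ge0 => k _ _; rewrite lee_fin; exact: pf_ge0.
Qed.

Lemma le_riesz_outer : {homo riesz_outer : A B / A `<=` B >-> A <= B}.
Proof.
move=> A B AB; apply: ereal_inf_le_tmp => _ [g [Cg g0 gB] <-].
by exists g => //; split => // x /AB; exact: gB.
Qed.

Lemma riesz_outer_le A g : Cc g -> (forall x, 0 <= g x)%R ->
  (forall x, A x -> 1 <= g x)%R -> riesz_outer A <= (L g)%:E.
Proof.
move=> Cg g0 gA; apply: ereal_inf_lbound.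
exists (fun k => if k is 0%N then g else (fun=> 0%R)).
  split; [by case=> [|k] //; exact: Cc0|by case|].
  by move=> x Ax; rewrite (@eseries_head _ (g x)%:E)// lee_fin gA.
by apply: eseries_head => // k; rewrite pf0.
Qed.

(** Any cover of [A] dominates [h] pointwise, so Daniell continuity of [L] applies. Together with
    [riesz_outer_le] this squeezes the outer measure of an open set between values of [L]. *)
Lemma riesz_outer_ge A h : Cc h -> (forall x, 0 <= h x <= 1)%R ->
  (forall x, ~ A x -> h x = 0%R) -> (L h)%:E <= riesz_outer A.
Proof.
move=> Ch h01 hA; apply: le_ereal_inf_tmp => _ [g [Cg g0 gA] <-].
apply: pf_daniell => //; first by move=> x; case/andP: (h01 x).
move=> x; have [Ax|nAx] := pselect (A x).
  by apply: le_trans (gA x Ax); rewrite lee_fin; case/andP: (h01 x).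
by rewrite hA//; apply: nneseries_ge0 => k _ _; rewrite lee_fin.
Qed.

Lemma riesz_outer0 : riesz_outer set0 = 0.
Proof.
apply/eqP; rewrite eq_le riesz_outer_ge0 andbT.
by apply: le_trans (riesz_outer_le Cc0 _ _) _ => //; rewrite pf0.
Qed.

Lemma riesz_outer_adherent A (e : R) : (0 < e)%R -> riesz_outer A \is a fin_num ->
  exists2 g, Cc_cover A g & \sum_(k <oo) (L (g k))%:E <= riesz_outer A + e%:E.
Proof.
move=> e0 fA; have [_ [g cg <-] /ltW gle] := lb_ereal_inf_adherent e0 fA.
by exists g.
Qed.

Lemma riesz_outer_sigma_subadditive : sigma_subadditive riesz_outer.
Proof.
move=> A; have [[i ioo]|] := pselect (exists i, riesz_outer (A i) = +oo).
  rewrite (eseries_pinfty _ _ ioo) ?leey// => n _.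
  by rewrite -ltNye (lt_le_trans _ (riesz_outer_ge0 _)).
rewrite -forallNE => Aoo.
have Afin n : riesz_outer (A n) \is a fin_num.
  by rewrite ge0_fin_numE ?riesz_outer_ge0// lt_neqAle leey andbT; exact/eqP.
apply/lee_addgt0Pr => e e0.
rewrite (le_trans _ (epsilon_trick _ _ (ltW e0)))//; last first.
  by move=> n; exact: riesz_outer_ge0.
have /choice[G GP] n : exists g, Cc_cover (A n) g /\
    \sum_(k <oo) (L (g k))%:E <= riesz_outer (A n) + (e / (2 ^ n.+1)%:R)%:E.
  have en : (0 < e / (2 ^ n.+1)%:R)%R by rewrite divr_gt0// ltr0n expn_gt0.
  by have [g cg gle] := riesz_outer_adherent en (Afin n); exists g.
have [f fE] := @double_nneseries R.
apply: (@le_trans _ _ (\sum_(n <oo) \sum_(k <oo) (L (G n k))%:E)).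
  rewrite -(fE (fun n k => (L (G n k))%:E)); last first.
    by move=> n k; rewrite lee_fin; apply: pf_ge0 => //; case: (GP n) => -[].
  apply: ereal_inf_lbound.
  exists (fun i => G (f i).1 (f i).2) => //; split.
  - by move=> i; case: (GP (f i).1) => -[].
  - by move=> i; case: (GP (f i).1) => -[].
  - move=> x [n _ Anx]; rewrite (fE (fun n k => (G n k x)%:E)); last first.
      by move=> m k; rewrite lee_fin; case: (GP m) => -[].
    rewrite (@nneseriesD1 _ _ n xpredT)//; last first.
      move=> m _; apply: nneseries_ge0 => k _ _; rewrite lee_fin.
      by case: (GP m) => -[].
    rewrite -[leLHS]adde0; apply: leeD; first by case: (GP n) => -[_ _ cG] _; exact: cG.
    apply: nneseries_ge0 => m _ _; apply: nneseries_ge0 => k _ _.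
    by rewrite lee_fin; case: (GP m) => -[].
apply: lee_nneseries => [n _ _|n _]; last exact: (GP n).2.
by apply: nneseries_ge0 => k _ _; rewrite lee_fin; apply: pf_ge0 => //; case: (GP n) => -[].
Qed.

Hypothesis Ts : @second_countable T.

Lemma riesz_outer_caratheodory (U A : set T) : open U ->
  riesz_outer (A `&` U) + riesz_outer (A `&` ~` U) <= riesz_outer A.
Proof.
move=> oU; have [phi [Cphi phi01 phim phiU phi1]] := @Cc_exhaustion R T Th Tl Ts U oU.
have phi0 n x : (0 <= phi n x)%R by case/andP: (phi01 n x).
have phile1 n x : (phi n x <= 1)%R by case/andP: (phi01 n x).
apply: le_ereal_inf_tmp => _ [g [Cg g0 gA] <-].
apply/lee_addgt0Pr => e e0.
(* prepending [0] makes the increments of [psi] telescope to [phi] *)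
pose psi n := if n is m.+1 then phi m else (fun=> 0%R).
have Cpsi n : Cc (psi n) by case: n => [|n] //=; exact: Cc0.
have psi0 n x : (0 <= psi n x)%R by case: n => [|n] //=.
have psile1 n x : (psi n x <= 1)%R by case: n => [|n] //=.
have psim x : {homo psi ^~ x : m n / (m <= n)%N >-> (m <= n)%R}.
  by move=> [|m] [|n] //= mn; exact: phim.
have psiU n x : ~ U x -> psi n x = 0%R by case: n => [|n] //= /phiU.
have psi1 x : U x -> exists n, psi n x = 1%R.
  by move=> /phi1[n /(_ n (leqnn n)) pn]; exists n.+1.
have Cgp k n : Cc (fun x => g k x * psi n x)%R.
  by apply: CcMr => //; exact: Cc_continuous.
pose l k n := L (fun x => g k x * psi n x)%R.
have lm k : {homo l k : m n / (m <= n)%N >-> (m <= n)%R}.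
  by move=> m n mn; apply: pf_le => // x; rewrite ler_wpM2l// psim.
have lL k n : (l k n <= L (g k))%R.
  by apply: pf_le => // x; rewrite ler_piMr.
have l0 k : l k 0%N = 0%R.
  rewrite /l -[RHS](pf0 posL); congr L; apply/funext => x.
  by rewrite /psi mulr0.
pose s k := sup (range (l k)).
have hs k : has_sup (range (l k)).
  by split; [exists (l k 0%N), 0%N|exists (L (g k)) => _ [n _ <-]].
have ls k n : (l k n <= s k)%R by apply: sup_upper_bound => //; exists n.
have es k (d : R) : (0 < d)%R -> exists n, (s k - d < l k n)%R.
  move=> d0; have [_ [n _ <-] lt] := sup_adherent d0 (hs k).
  by exists n.
have sL k : (s k <= L (g k))%R.
  by apply: ge_sup; [exact: (hs k).1|move=> _ [n _ <-]].
have s0 k : (0 <= s k)%R by rewrite -(l0 k).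
(* [s k] is the cost of the part of [g k] carried by [U]. Stopping at index [j k] loses at most
   [e / 2^(k+1)], which sums over [k] to [e]. *)
have /choice[j jP] k : exists n, (s k - e / (2 ^ k.+1)%:R < l k n)%R.
  by apply: es; rewrite divr_gt0// ltr0n expn_gt0.
have AU : riesz_outer (A `&` U) <= \sum_(k <oo) (s k)%:E.
  have [f fE] := @double_nneseries R.
  pose h k n x := (g k x * psi n.+1 x - g k x * psi n x)%R.
  have Ch k n : Cc (h k n) by exact: CcB.
  have h0 k n x : (0 <= h k n x)%R.
    by rewrite /h -mulrBr mulr_ge0// subr_ge0 psim.
  have Lh k n : L (h k n) = (l k n.+1 - l k n)%R by rewrite pfB.
  apply: ereal_inf_lbound; exists (fun i => h (f i).1 (f i).2).
    split => // x [Ax Ux]; rewrite (fE (fun k n => (h k n x)%:E)); last first.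
      by move=> k n; rewrite lee_fin.
    rewrite (le_trans (gA x Ax))// le_eqVlt; apply/orP; left; apply/eqP.
    apply: eq_eseriesr => k _; apply/esym.
    apply: (@nneseries_telescope _ (fun n => g k x * psi n x)%R).
    - by rewrite /psi mulr0.
    - by move=> m n mn; rewrite ler_wpM2l// psim.
    - by move=> n; rewrite ler_piMr.
    - move=> d d0; have [n pn] := psi1 x Ux; exists n.
      by rewrite pn mulr1 ltrBlDr ltrDl.
  rewrite (fE (fun k n => (L (h k n))%:E)); last first.
    by move=> k n; rewrite lee_fin pf_ge0.
  apply: eq_eseriesr => k _; under eq_eseriesr do rewrite Lh.
  by apply: nneseries_telescope => // d; exact: es.
(* Off [U] every [psi n] vanishes, so removing [g k * psi (j k)] for a finite index does not spoil
   the cover there. *)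
have AnU : riesz_outer (A `&` ~` U) <= \sum_(k <oo) (L (g k) - l k (j k))%:E.
  apply: ereal_inf_lbound; exists (fun k x => g k x - g k x * psi (j k) x)%R.
    split; [by move=> k; exact: CcB| |].
      by move=> k x; rewrite subr_ge0 ler_piMr.
    move=> x [Ax nUx]; rewrite (le_trans (gA x Ax))//.
    apply: lee_nneseries => [k _ _|k _]; rewrite lee_fin// psiU//.
    by rewrite mulr0 subr0.
  by apply: eq_eseriesr => k _; rewrite pfB.
apply: le_trans (leeD AU AnU) _.
rewrite -nneseriesD; last 2 first.
- by move=> k _ _; rewrite lee_fin.
- by move=> k _ _; rewrite lee_fin subr_ge0.
apply: le_trans (epsilon_trick _ _ (ltW e0)); last first.
  by move=> k; rewrite lee_fin pf_ge0.
apply: lee_nneseries => [k _ _|k _]; rewrite -EFinD lee_fin.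
  by rewrite addr_ge0// subr_ge0.
by have := jP k; lra.
Qed.

End riesz_outer_measure.

(** * Integration against Radon measures: existence and uniqueness of the representing measure *)

Section radon_integral.
Context {R : realType} {T : ptopologicalType}.
Hypothesis Th : hausdorff_space T.
Implicit Types (f g : T -> R) (xi : radon R T).

Lemma open_borel (U : set T) : open U -> measurable (U : set (borelT T)).
Proof. by move=> oU; apply: sub_sigma_algebra. Qed.

Lemma closed_borel (F : set T) : closed F -> measurable (F : set (borelT T)).
Proof.
by move=> cF; rewrite -[F]setCK; apply: measurableC; apply: open_borel; exact: closed_openC.
Qed.

Lemma continuous_borel f : continuous f ->
  measurable_fun [set: borelT T] (f : borelT T -> R).
Proof.
move=> cf; apply: (measurability _ (RGenOpens.measurableE R)).
move=> _ [_ [a [b ->] <-]]; rewrite setTI; apply: open_borel.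
apply: (@open_comp _ _ f); last exact: interval_open.
by move=> y _; exact: cf.
Qed.

Lemma Cc_integrable xi f : Cc f -> xi.-integrable setT (EFin \o (f : borelT T -> R)).
Proof.
move=> Cf; have [M [M0 fM]] := Cc_bounded Cf.
pose K := closure [set x | f x != 0].
have mK : measurable (K : set (borelT T)) by apply: closed_borel; exact: closed_closure.
have -> : EFin \o f = (EFin \o f) \_ K.
  apply/funext => x; rewrite [RHS]patchE; case: ifPn => // /negP xK /=.
  have [->//|fx] := eqVneq (f x) 0; exfalso; apply: xK; apply/mem_set.
  exact: subset_closure.
apply: (@integrable_mkcond _ (borelT T) R xi K (EFin \o f) mK).1.
apply: measurable_bounded_integrable => //.
- by apply: rmeas_fin; exact: Cf.2.
- by apply: measurable_funTS; apply: continuous_borel; exact: Cf.1.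
- exists M; split; first by rewrite num_real.
  by move=> y My x _; rewrite /= (le_trans (fM x))// ltW.
Qed.

Lemma rint_pf xi : positive_functional (rint xi).
Proof.
split=> [f g Cf Cg|c f Cf|f Cf f0].
- by apply: RintegralD => //; exact: Cc_integrable.
- by apply: RintegralZl => //; exact: Cc_integrable.
- by apply: fine_ge0; apply: integral_ge0 => x _; rewrite lee_fin.
Qed.

Lemma rintE xi f : Cc f -> ((rint xi f)%:E = \int[xi]_x (f x)%:E)%E.
Proof.
by move=> Cf; rewrite fineK//; apply: integrable_fin_num => //; exact: Cc_integrable.
Qed.

Lemma rint_le_measure xi f (A : set T) : Cc f -> open A ->
  (forall x, 0 <= f x <= 1) -> (forall x, ~ A x -> f x = 0) ->
  ((rint xi f)%:E <= xi A)%E.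
Proof.
move=> Cf oA f01 fA; rewrite rintE// -[X in (_ <= _ X)%E](setIT (A : set (borelT T))).
have mA := open_borel oA.
rewrite -integral_indic//; apply: ge0_le_integral => //.
- by move=> x _; rewrite lee_fin; case/andP: (f01 x).
- by apply/measurable_EFinP; apply: continuous_borel; exact: Cf.1.
- by apply/measurable_EFinP; exact: measurable_indic.
- move=> x _; rewrite lee_fin indicE; case: (boolP (x \in A)) => [_|/negP xA].
    by case/andP: (f01 x).
  by rewrite fA// => Ax; apply: xA; exact/mem_set.
Qed.

Lemma measure_le_rint xi f (A : set T) : Cc f -> open A ->
  (forall x, 0 <= f x) -> (forall x, A x -> 1 <= f x) ->
  (xi A <= (rint xi f)%:E)%E.
Proof.
move=> Cf oA f0 fA; rewrite rintE// -[X in (_ X <= _)%E](setIT (A : set (borelT T))).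
have mA := open_borel oA.
rewrite -integral_indic//; apply: ge0_le_integral => //.
- by apply/measurable_EFinP; exact: measurable_indic.
- by apply/measurable_EFinP; apply: continuous_borel; exact: Cf.1.
- move=> x _; rewrite lee_fin indicE; case: (boolP (x \in A)) => [xA|_]; last exact: f0.
  by apply: fA; exact: set_mem.
Qed.

Hypotheses (Tl : locally_compact [set: T]) (Ts : @second_countable T).

(** On open sets the measure [xi] is the outer measure, which bounds and is bounded by values of
    [L]; the same holds with the integral against [xi] in place of [L]. Hence [pf_slice_le] applies
    in both directions to nonnegative functions, and positive and negative parts give the rest. *)
Theorem riesz_representation (L : (T -> R) -> R) : positive_functional L ->
  exists xi : radon R T, forall f, Cc f -> rint xi f = L f.
Proof.
move=> posL.
pose mu : {outer_measure set T -> \bar R} := HB.pack (riesz_outer L)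
  (isOuterMeasure.Build R T (riesz_outer L) (riesz_outer0 posL)
    (riesz_outer_ge0 posL) (@le_riesz_outer _ _ L)
    (riesz_outer_sigma_subadditive posL)).
have bc (A : set (borelT T)) : measurable A -> mu.-caratheodory A.
  move: A; apply: smallest_sub; first exact: sigma_algebra_measurable (caratheodory_type mu).
  move=> U oU; apply: le_caratheodory_measurable => X.
  exact: riesz_outer_caratheodory.
have msa : semi_sigma_additive (mu : set (borelT T) -> \bar R).
  move=> F mF tF mUF.
  apply: (@caratheodory_measure_sigma_additive _ _ mu) => //.
    by move=> i; exact: bc.
  exact: bc.
pose nu : {measure set (borelT T) -> \bar R} := HB.pack
  (riesz_outer L : set (borelT T) -> \bar R)
  (isMeasure.Build _ (borelT T) R (riesz_outer L : set (borelT T) -> \bar R)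
    (riesz_outer0 posL) (riesz_outer_ge0 posL) msa).
have nuf (K : set T) : compact K -> (nu K < +oo)%E.
  move=> cK; have [h [Ch h0 hK]] := @Cc_cutoff R T Th Tl K cK.
  by rewrite (le_lt_trans (riesz_outer_le posL Ch h0 hK))// ltry.
pose xi := Radon nuf; exists xi.
have posI := rint_pf xi.
have pos f : Cc f -> (forall x, 0 <= f x) -> rint xi f = L f.
  move=> Cf f0; apply/eqP; rewrite eq_le; apply/andP; split.
    apply: (@pf_slice_le R T (rint xi) L) => // u v A Cu Cv oA u01 uA v0 vA.
    rewrite -lee_fin (le_trans (rint_le_measure xi Cu oA u01 uA))//.
    exact: riesz_outer_le.
  apply: (@pf_slice_le R T L (rint xi)) => // u v A Cu Cv oA u01 uA v0 vA.
  rewrite -lee_fin (le_trans _ (measure_le_rint xi Cv oA v0 vA))//.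
  exact: riesz_outer_ge.
move=> f Cf.
have cz : continuous (fun _ : T => 0 : R) by move=> ?; exact: cst_continuous.
have Cp : Cc (fun x => Num.max (f x) 0).
  apply: (Cc_supported1 Cf); last by move=> x ->; rewrite maxxx.
  apply: max_continuousR; [exact: Cf.1|exact: cz].
have Cn : Cc (fun x => Num.max (- f x) 0).
  apply: (Cc_supported1 Cf); last by move=> x ->; rewrite oppr0 maxxx.
  apply: max_continuousR; [exact: (CcN Cf).1|exact: cz].
have -> : f = (fun x => Num.max (f x) 0 - Num.max (- f x) 0).
  by apply/funext => x; case: (leP (f x) 0); case: (leP (- f x) 0); lra.
rewrite (pfB posI)// (pfB posL)// !pos// => x; by rewrite le_max lexx orbT.
Qed.

(** By monotone convergence along an exhaustion, the integrals determine the measure of each open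
    set. Open sets are stable under intersection and generate the Borel sets, and the space is a
    countable union of the sets [{phi n > 0}], which have finite measure since they lie in compact
    supports. *)
Theorem radon_unique (xi eta : radon R T) :
  (forall f, Cc f -> rint xi f = rint eta f) -> meq xi eta.
Proof.
move=> xe; have [phi [Cphi phi01 phim phiU phi1]] := @Cc_exhaustion R T Th Tl Ts setT openT.
have oP n : open [set x | 0 < phi n x].
  apply: (@open_comp _ _ (phi n) [set z | 0 < z]); last exact: open_gt.
  by move=> y _; exact: (Cphi n).1.
have fin (zeta : radon R T) n : (zeta [set x | (0 < phi n x)%R] < +oo)%E.
  have K : compact (closure [set x | phi n x != 0]) by exact: (Cphi n).2.
  apply: le_lt_trans (rmeas_fin zeta K); apply: le_measure.
  - by apply: mem_set; exact: open_borel.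
  - by apply: mem_set; apply: closed_borel; exact: closed_closure.
  - by move=> x /= px; apply: subset_closure => /=; rewrite gt_eqF.
have openE (zeta : radon R T) (U : set T) (psi : nat -> T -> R) : open U ->
  (forall n, Cc (psi n)) -> (forall n x, 0 <= psi n x <= 1) ->
  (forall x, nondecreasing_seq (psi ^~ x)) -> (forall n x, ~ U x -> psi n x = 0) ->
  (forall x, U x -> exists n, forall m, (n <= m)%N -> psi m x = 1) ->
  ((rint zeta (psi n))%:E @[n --> \oo] --> zeta U)%E.
  move=> oU Cpsi psi01 psim psiU psi1.
  have mU := open_borel oU.
  rewrite -[X in _ --> zeta X](setIT (U : set (borelT T))) -integral_indic//.
  rewrite (_ : (fun n => _) = (fun n => \int[zeta]_x (psi n x)%:E)%E); last first.
    by apply/funext => n; exact: rintE.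
  have -> : (\int[zeta]_x (\1_U x)%:E =
             \int[zeta]_x limn (fun n => (psi n x)%:E))%E.
    apply: eq_integral => x _; apply/esym/cvg_lim => //.
    rewrite indicE; case: (boolP (x \in U)) => [|/negP] xU.
      have [n np] := psi1 x (set_mem xU).
      apply: cvg_near_cst; exists n => // m /= nm; by rewrite np.
    apply: cvg_near_cst; apply: nearW => n; rewrite psiU// => Ux; apply: xU.
    exact/mem_set.
  apply: cvg_monotone_convergence => //.
  - by move=> n; apply/measurable_EFinP; apply: continuous_borel; exact: (Cpsi n).1.
  - by move=> n x _; rewrite lee_fin; case/andP: (psi01 n x).
  - by move=> x _ m n mn; rewrite lee_fin; exact: psim.
move=> A mA.
apply: (@measure_unique _ _ (borelT T) (@open T) (fun n => [set x | (0 < phi n x)%R])) => //.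
- by move=> U V; exact: openI.
- rewrite -subTset => x _; have [n np] := phi1 x I; exists n => //=.
  by rewrite np.
- move=> U oU; have [psi [Cpsi psi01 psim psiU psi1]] := @Cc_exhaustion R T Th Tl Ts U oU.
  have h1 := openE xi U psi oU Cpsi psi01 psim psiU psi1.
  have h2 := openE eta U psi oU Cpsi psi01 psim psiU psi1.
  rewrite -(cvg_lim _ h1)// -(cvg_lim _ h2)//; congr (lim (_ @ \oo)).
  by apply/funext => n; rewrite xe.
Qed.

End radon_integral.

(** * Large deviation bounds on the exponential scale *)

Section ereal_asymptotics.
Context {R : realType}.
Implicit Types (x y J : \bar R) (u p : nat -> \bar R) (a : nat -> R).
Local Open Scope ereal_scope.

Lemma ereal_between x y : x < y -> exists r : R, x < r%:E /\ r%:E < y.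
Proof.
case: x => [s| |]; case: y => [t| |] //; rewrite ?lte_fin => xy.
- by exists ((s + t) / 2)%R; rewrite !lte_fin; split; lra.
- by exists (s + 1)%R; rewrite lte_fin ltry; split => //; lra.
- by exists (t - 1)%R; rewrite lte_fin ltNyr; split => //; lra.
- by exists 0%R; rewrite ltNyr ltry.
Qed.

Lemma limn_esup_leP u x : limn_esup u <= x <->
  forall b : R, x < b%:E -> \forall n \near \oo, u n <= b%:E.
Proof.
split=> [ux b xb|H].
  have : limn_esup u < b%:E by exact: le_lt_trans xb.
  rewrite /limn_esup limf_esupE => /ereal_inf_lt[_ [V nV <-]] sV.
  apply: filterS nV => n Vn; apply: le_trans (ltW sV).
  by apply: ereal_sup_ubound; exists n.
rewrite leNgt; apply/negP => /ereal_between[b [xb bu]].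
have := H b xb => nb; move: bu; apply/negP; rewrite -leNgt.
rewrite /limn_esup limf_esupE.
apply: (@le_trans _ _ (ereal_sup (u @` [set n | u n <= b%:E]))).
  by apply: ereal_inf_lbound; exists [set n | u n <= b%:E].
by apply: ge_ereal_sup => _ [n un <-].
Qed.

Lemma limn_einf_geP u x : x <= limn_einf u <->
  forall b : R, b%:E < x -> \forall n \near \oo, b%:E <= u n.
Proof.
have -> : (x <= limn_einf u) = (limn_esup (\- u) <= - x).
  by rewrite /limn_einf leeNr.
rewrite limn_esup_leP; split => H b bx.
  have := H (- b)%R; rewrite EFinN lteN2 => /(_ bx).
  by apply: filterS => n; rewrite leeN2.
have := H (- b)%R; rewrite EFinN lteNl => /(_ bx).
by apply: filterS => n; rewrite leeNl.
Qed.

Lemma elog_le (p : \bar R) (r : R) : 0 <= p ->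
  (elog p <= r%:E) = (p <= (expR r)%:E).
Proof.
rewrite /elog; case: eqP => [-> _|/eqP p0 pge]; first by rewrite leNye lee_fin expR_ge0.
case: eqP => [->|/eqP py]; first by rewrite !leye_eq.
case: p p0 pge py => [p| |] //; rewrite eqe lee_fin /= => p0 pge _.
have pgt : (0 < p)%R by rewrite lt_neqAle eq_sym p0.
by rewrite !lee_fin -[in RHS](lnK pgt) ler_expR.
Qed.

Lemma elog_ge (p : \bar R) (r : R) : 0 <= p ->
  (r%:E <= elog p) = ((expR r)%:E <= p).
Proof.
rewrite /elog; case: eqP => [-> _|/eqP p0 pge].
  by rewrite leeNy_eq /= lee_fin leNgt expR_gt0.
case: eqP => [->|/eqP py]; first by rewrite !leey.
case: p p0 pge py => [p| |] //; rewrite eqe lee_fin /= => p0 pge _.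
have pgt : (0 < p)%R by rewrite lt_neqAle eq_sym p0.
by rewrite !lee_fin -[in RHS](lnK pgt) ler_expR.
Qed.

Lemma scaled_elog_le (a : R) (p : \bar R) (b : R) : (0 < a)%R -> 0 <= p ->
  ((a^-1)%:E * elog p <= b%:E) = (p <= (expR (a * b))%:E).
Proof. by move=> a0 p0; rewrite lee_pdivrMl// -EFinM elog_le. Qed.

Lemma scaled_elog_ge (a : R) (p : \bar R) (b : R) : (0 < a)%R -> 0 <= p ->
  (b%:E <= (a^-1)%:E * elog p) = ((expR (a * b))%:E <= p).
Proof. by move=> a0 p0; rewrite lee_pdivlMl// -EFinM elog_ge. Qed.

(** With its counterpart [log_lowerP] this trades the extended logarithm for comparisons of [p n]
    with real exponentials, so zero probabilities need no separate treatment later. *)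
Lemma log_upperP a p J : (forall n, 0 < a n)%R -> (forall n, 0 <= p n) ->
  limn_esup (fun n => ((a n)^-1)%:E * elog (p n)) <= - J <->
  forall b : R, b%:E < J -> \forall n \near \oo, p n <= (expR (- (a n * b)))%:E.
Proof.
move=> a0 p0; rewrite limn_esup_leP; split => H b bJ.
  have := H (- b)%R; rewrite EFinN lteN2 => /(_ bJ); apply: filterS => n.
  by rewrite -EFinN scaled_elog_le// mulrN.
have := H (- b)%R; rewrite EFinN lteNl => /(_ bJ); apply: filterS => n.
by rewrite scaled_elog_le// mulrN opprK.
Qed.

Lemma log_lowerP a p J : (forall n, 0 < a n)%R -> (forall n, 0 <= p n) ->
  - J <= limn_einf (fun n => ((a n)^-1)%:E * elog (p n)) <->
  forall b : R, J < b%:E -> \forall n \near \oo, (expR (- (a n * b)))%:E <= p n.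
Proof.
move=> a0 p0; rewrite limn_einf_geP; split => H b bJ.
  have := H (- b)%R; rewrite EFinN lteN2 => /(_ bJ); apply: filterS => n.
  by rewrite -EFinN scaled_elog_ge// mulrN.
have := H (- b)%R; rewrite EFinN lteNr => /(_ bJ); apply: filterS => n.
by rewrite scaled_elog_ge// mulrN opprK.
Qed.

End ereal_asymptotics.

(** * Covering compactness and attained minima *)

Section compact_wrt_theory.
Context {R : realType} {S : Type} (opn : set S -> Prop).

Lemma compact_wrt_nested (K : set S) (U : nat -> set S) :
  compact_wrt opn K -> (forall k, opn (U k)) ->
  (forall m n, (m <= n)%N -> U m `<=` U n) -> K `<=` \bigcup_k U k ->
  exists k, K `<=` U k.
Proof.
move=> cK oU mU KU.
have [||D /finite_seqP[s Ds] [DU KD]] := cK (range U).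
- by move=> _ [k _ <-].
- by move=> x /KU[k _ Ux]; exists (U k) => //; exists k.
have [k kP] : exists k, forall V, V \in s -> V `<=` U k.
  have : forall V, V \in s -> range U V by move=> V Vs; apply: DU; rewrite Ds.
  elim: s {Ds} => [|V s IH] rs; first by exists 0%N.
  have [k kP] := IH (fun V' h => rs V' (mem_behead (s := V :: s) h)).
  have [j _ jV] := rs V (mem_head V s).
  exists (maxn k j) => W; rewrite inE => /orP[/eqP->|Ws].
    by rewrite -jV; apply: mU; exact: leq_maxr.
  by apply: subset_trans (kP W Ws) _; apply: mU; exact: leq_maxl.
exists k => x /KD[V DV Vx]; apply: kP Vx.
by move: DV; rewrite Ds.
Qed.

Lemma compact_wrt_sub (K F : set S) : compact_wrt opn K -> opn (~` F) ->
  F `<=` K -> compact_wrt opn F.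
Proof.
move=> cK oF FK C Co FC.
have [||D fD [DC KD]] := cK (C `|` [set ~` F]).
- by move=> U [/Co//|->].
- move=> x _; have [Fx|nFx] := pselect (F x).
    by have [U CU Ux] := FC _ Fx; exists U => //; left.
  by exists (~` F) => //; right.
exists (D `&` C); first by apply: sub_finite_set fD => U [].
split; first by move=> U [].
move=> x Fx; have [U DU Ux] := KD _ (FK _ Fx); exists U => //; split => //.
by case: (DC _ DU) => // UF; move: Ux; rewrite UF.
Qed.

(** Were the infimum [m] not attained, the open sets [{I > m + 1/(k+1)}] would cover the compact set
    [{I <= m + 1}]; a single one would then do so, contradicting the definition of [m]. *)
Lemma good_rate_min (I : S -> \bar R) : good_rate opn I ->
  (exists x, I x < +oo)%E -> exists x, forall y, (I x <= I y)%E.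
Proof.
move=> [I0 Io Ic] [x0 x0y].
pose m := ereal_inf (range I).
have m0 : (0 <= m)%E by apply: le_ereal_inf_tmp => _ [x _ <-].
have mI x : (m <= I x)%E by apply: ereal_inf_lbound; exists x.
have mfin : m \is a fin_num by rewrite ge0_fin_numE// (le_lt_trans (mI x0)).
apply: contrapT => nomin.
have mltI x : (m < I x)%E.
  rewrite ltNge; apply/negP => Im; apply: nomin; exists x => y.
  exact: le_trans (mI y).
pose c k := (fine m + k.+1%:R^-1)%R.
have mE : m = (fine m)%:E by rewrite fineK.
have cmono j k : (j <= k)%N -> (c k <= c j)%R.
  by move=> jk; rewrite lerD2l lef_pV2 ?posrE// ler_nat.
have [||k kP] := @compact_wrt_nested _ (fun k => ~` [set x | I x <= (c k)%:E]%E)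
    (Ic (c 0%N)) (fun k => Io (c k)).
- move=> j k jk x /= Ix Ik; apply: Ix; apply: le_trans Ik _.
  by rewrite lee_fin; exact: cmono.
- move=> x _; have [r []] := ereal_between (mltI x).
  rewrite mE lte_fin => mr rI; exists (Num.truncn (r - fine m)^-1) => //=.
  apply/negP; rewrite -ltNge; apply: le_lt_trans rI.
  rewrite lee_fin /c -lerBrDl invf_ple ?posrE ?subr_gt0//.
  exact/ltW/truncnS_gt.
have : (ereal_inf (range I) < (c k)%:E)%E by rewrite -/m mE lte_fin ltrDl.
move=> /ereal_inf_lt[_ [x _ <-] Ix]; apply: (kP x) (ltW Ix) => /=.
by apply: le_trans (ltW Ix) _; rewrite lee_fin; exact: cmono.
Qed.

End compact_wrt_theory.

Section ldp_transfer.
Context {R : realType} {d : measure_display} {Om : measurableType d}.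
Variables (P : probability Om R) (a : nat -> R).
Hypothesis a0 : forall n, 0 < a n.
Context {S : Type} (opn : set S -> Prop) (X : nat -> Om -> S) (I : S -> \bar R).
Hypothesis ldpX : LDP P opn X a I.

Lemma LDP_upper (F : set S) (c b : R) : opn (~` F) ->
  (forall x, F x -> (c%:E <= I x)%E) -> b < c ->
  \forall n \near \oo, (P (X n @^-1` F) <= (expR (- (a n * b)))%:E)%E.
Proof.
move=> oF Fc bc; have [+ _] := ldpX.
move=> /(_ F oF)/log_upperP; apply => //.
apply: lt_le_trans (_ : c%:E <= _)%E; first by rewrite lte_fin.
by apply: le_ereal_inf_tmp => _ [x Fx <-]; exact: Fc.
Qed.

Lemma LDP_lower (G : set S) (x : S) (b : R) : opn G -> G x -> (I x < b%:E)%E ->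
  \forall n \near \oo, ((expR (- (a n * b)))%:E <= P (X n @^-1` G))%E.
Proof.
move=> oG Gx Ib; have [_ +] := ldpX.
move=> /(_ G oG)/log_lowerP; apply => //.
by apply: le_lt_trans Ib; apply: ereal_inf_lbound; exists x.
Qed.

End ldp_transfer.

Section ldp_compare.
Context {R : realType} {d : measure_display} {Om : measurableType d}.
Variables (P : probability Om R) (a : nat -> R).
Hypothesis a0 : forall n, 0 < a n.

(** If [J >= b] on all of [C], the event for [Y] decays at any rate below [b], while the smaller
    event for [X] decays no faster than some rate [b' < b]. The midpoint of [b'] and [b] separates
    the two. *)
Lemma LDP_compare (S1 S2 : Type) (opn1 : set S1 -> Prop) (opn2 : set S2 -> Prop)
    (X : nat -> Om -> S1) (Y : nat -> Om -> S2) (I : S1 -> \bar R) (J : S2 -> \bar R)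
    (G : set S1) (C : set S2) (x : S1) (b : R) :
  LDP P opn1 X a I -> LDP P opn2 Y a J -> opn1 G -> opn2 (~` C) ->
  (forall n, measurable (X n @^-1` G)) -> (forall n, measurable (Y n @^-1` C)) ->
  (forall n, X n @^-1` G `<=` Y n @^-1` C) -> G x -> (I x < b%:E)%E ->
  exists2 y, C y & (J y < b%:E)%E.
Proof.
move=> lX lY oG oC mG mC GC Gx Ib; apply: contrapT => noy.
have Cb y : C y -> (b%:E <= J y)%E.
  by move=> Cy; rewrite leNgt; apply/negP => Jb; apply: noy; exists y.
have [b' [Ib']] := ereal_between Ib; rewrite lte_fin => b'b.
have n1 := LDP_lower a0 lX oG Gx Ib'.
have b'b2 : (b' + b) / 2 < b by lra.
have n2 := LDP_upper a0 lY oC Cb b'b2.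
near \oo => n.
have h1 : ((expR (- (a n * b')))%:E <= P (X n @^-1` G))%E by near: n.
have h2 : (P (Y n @^-1` C) <= (expR (- (a n * ((b' + b) / 2))))%:E)%E by near: n.
have h3 : (P (X n @^-1` G) <= P (Y n @^-1` C))%E by apply: le_measure; [exact/mem_set|exact/mem_set|exact: GC].
have := le_trans h1 (le_trans h3 h2).
rewrite lee_fin ler_expR lerN2 ler_pM2l//; lra.
Unshelve. all: by end_near. Qed.

End ldp_compare.

(** * Varadhan's lemma for a real random variable *)

Section varadhan.
Context {R : realType} {d : measure_display} {Om : measurableType d}.
Variables (P : probability Om R) (a : nat -> R).
Hypotheses (a0 : forall n, 0 < a n) (ay : a n @[n --> \oo] --> +oo).
Variables (Y : nat -> Om -> R) (mY : forall n, measurable_fun setT (Y n)).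
Variable I : R -> \bar R.
Hypothesis I0 : forall z, (0 <= I z)%E.
Hypothesis lower : forall z e b, 0 < e -> (I z < b%:E)%E ->
  \forall n \near \oo, ((expR (- (a n * b)))%:E <= P (Y n @^-1` `](z - e)%R, (z + e)%R[))%E.
Hypothesis upper : forall z1 z2 c b,
  (forall z, z1 <= z <= z2 -> (c%:E <= I z)%E) -> b < c ->
  \forall n \near \oo, (P (Y n @^-1` `[z1, z2]) <= (expR (- (a n * b)))%:E)%E.

Local Notation E n := (\int[P]_w (expR (a n * Y n w))%:E)%E.

Let mexp (c : R) n : measurable_fun setT (fun w => (expR (a n * (c * Y n w)))%:E).
Proof.
apply/measurable_EFinP; apply: measurableT_comp; first exact: measurable_expR.
by apply: measurable_funM => //; apply: measurable_funM.
Qed.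

Let mexp1 n : measurable_fun setT (fun w => (expR (a n * Y n w))%:E).
Proof. by have := mexp 1 n; under eq_fun do rewrite mul1r. Qed.

Let mcell n (i : interval R) : measurable (Y n @^-1` [set` i]).
Proof.
by rewrite -[X in measurable X]setTI; apply: mY => //; exact: measurable_itv.
Qed.

(** The expectation is restricted to [|Y - z| < e], where the integrand is at least
    [exp (a (z - e))]. *)
Lemma exp_moment_lower z e b : 0 < e -> (I z < b%:E)%E ->
  \forall n \near \oo, ((expR (a n * (z - e - b)))%:E <= E n)%E.
Proof.
move=> e0 Ib; apply: filterS (lower e0 Ib) => n Pn.
pose A := Y n @^-1` `]z - e, z + e[.
apply: (@le_trans _ _ ((expR (a n * (z - e)))%:E * P A)%E).
  rewrite mulrBr expRD EFinM lee_pmul2l ?lte_fin ?expR_gt0//.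
rewrite -(integral_cst P (mcell n _)).
apply: (@le_trans _ _ (\int[P]_(w in A) (expR (a n * Y n w))%:E)%E).
  apply: ge0_le_integral => //.
  - by move=> w _; rewrite lee_fin expR_ge0.
  - exact: measurable_funTS.
  - move=> w; rewrite /A /= in_itv/= => /andP[zY _].
    by rewrite lee_fin ler_expR ler_pM2l// ltW.
apply: ge0_subset_integral => //; exact: mcell.
Qed.

Variables C1 C2 : R.
Hypothesis mom1 : forall n, (E n <= (expR (a n * C1))%:E)%E.
Hypothesis mom2 : forall n,
  (\int[P]_w (expR (a n * (2 * Y n w)))%:E <= (expR (a n * C2))%:E)%E.

(* Where [Y >= M], [exp (a Y) <= exp (- a M) * exp (2 a Y)], which [mom2]
   controls; the range [-M, M] is cut into [N] cells of width [e]. *)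
Lemma exp_moment_split (M e : R) (N : nat) n : 0 < M -> 0 < e -> 2 * M <= N%:R * e ->
  (E n <= (expR (- (a n * M)))%:E + ((expR (- (a n * M)))%:E * (expR (a n * C2))%:E +
    \sum_(j < N) (expR (a n * (- M + j.+1%:R * e)))%:E *
      P (Y n @^-1` `[(- M + j%:R * e)%R, (- M + j.+1%:R * e)%R])))%E.
Proof.
move=> M0 e0 MN.
pose A j := Y n @^-1` `[- M + j%:R * e, - M + j.+1%:R * e].
pose f2 w := ((expR (- (a n * M)))%:E * (expR (a n * (2 * Y n w)))%:E)%E.
pose f3 w := (\sum_(j < N) (expR (a n * (- M + j.+1%:R * e)))%:E * (\1_(A j) w)%:E)%E.
have mA j : measurable (A j) by exact: mcell.
have f20 w : (0 <= f2 w)%E by rewrite mule_ge0// lee_fin expR_ge0.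
have f30 w : (0 <= f3 w)%E.
  by apply: sume_ge0 => j _; rewrite mule_ge0// lee_fin ?expR_ge0// indicE.
have mf2 : measurable_fun setT f2 by apply: measurable_funeM.
have mind j : measurable_fun setT (fun w => (\1_(A j) w)%:E : \bar R).
  by apply/measurable_EFinP; exact: measurable_indic.
have mf3 : measurable_fun setT f3.
  by apply: emeasurable_sum => j; exact: measurable_funeM.
have f230 w : (0 <= f2 w + f3 w)%E by rewrite adde_ge0.
have mf23 : measurable_fun setT (fun w => f2 w + f3 w)%E by exact: emeasurable_funD.
apply: (@le_trans _ _ (\int[P]_w (cst (expR (- (a n * M)))%:E w + (f2 w + f3 w)))%E).
  apply: ge0_le_integral => //.
  - by apply: emeasurable_funD => //; exact: measurable_cst.
  - move=> w _; have [YM|MY] := leP (Y n w) (- M).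
      rewrite -[leLHS]adde0 leeD// lee_fin ler_expR -mulrN ler_pM2l//.
    have [YM|YM] := leP M (Y n w).
      rewrite -[leLHS]add0e leeD//; first by rewrite lee_fin expR_ge0.
      rewrite -[leLHS]adde0 leeD// /f2 -EFinM -expRD lee_fin ler_expR.
      rewrite -mulrN -mulrDr ler_pM2l//; move: YM; lra.
    rewrite -[leLHS]add0e leeD//; first by rewrite lee_fin expR_ge0.
    rewrite -[leLHS]add0e leeD//.
    pose t := (Y n w + M) / e.
    have t0 : 0 <= t by rewrite divr_ge0 ?(ltW e0)//; move: MY; lra.
    have /andP[k1 k2] := truncn_itv t0.
    set k := Num.truncn t in k1 k2.
    have tE : Y n w = - M + t * e by rewrite /t divfK ?gt_eqF//; lra.
    have kN : (k < N)%N.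
      rewrite -(ltr_nat R); apply: le_lt_trans k1 _.
      by rewrite /t ltr_pdivrMr//; move: YM MN; lra.
    rewrite /f3 (bigD1 (Ordinal kN))//= -[leLHS]adde0 leeD//; last first.
      by apply: sume_ge0 => j _; rewrite mule_ge0// lee_fin ?expR_ge0// indicE.
    have Aw : A k w.
      rewrite /A /= in_itv/= tE; apply/andP; split.
        by rewrite lerD2l ler_pM2r.
      by rewrite lerD2l ler_pM2r// ltW.
    rewrite indicE mem_set// mule1 lee_fin ler_expR ler_pM2l//.
    by move: Aw; rewrite /A /= in_itv/= => /andP[].
rewrite ge0_integralD//; last by move=> w _; rewrite lee_fin expR_ge0.
have -> : (\int[P]_x cst (expR (- (a n * M)))%:E x)%E = (expR (- (a n * M)))%:E.
  apply: (etrans (integral_cst P measurableT _)).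
  by rewrite [X in (_ * X)%E](@probability_setT _ _ _ P) mule1.
rewrite ge0_integralD// leeD// leeD//.
  have -> : (\int[P]_x f2 x = (expR (- (a n * M)))%:E *
      \int[P]_w (expR (a n * (2 * Y n w)))%:E)%E.
    by apply: ge0_integralZl_EFin => // *; rewrite ?lee_fin expR_ge0.
  by rewrite lee_pmul2l ?lte_fin ?expR_gt0.
rewrite ge0_integral_sum//.
- apply: lee_sum => j _.
  rewrite [leLHS](_ : _ = (expR (a n * (- M + j.+1%:R * e)))%:E *
      \int[P]_w (\1_(A j) w)%:E)%E.
    by rewrite integral_indic// setIT.
  by apply: ge0_integralZl_EFin => // *; rewrite ?lee_fin ?expR_ge0 ?indicE.
- by move=> j; exact: measurable_funeM.
Qed.

Lemma varadhan_linear : (exists z b, (I z < b%:E)%E) -> exists S : R,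
  [/\ forall z, (z%:E <= S%:E + I z)%E,
      forall S' : R, (forall z, (z%:E <= S'%:E + I z)%E) -> S <= S',
      forall b, b < S -> \forall n \near \oo, ((expR (a n * b))%:E <= E n)%E &
      forall b, S < b -> \forall n \near \oo, (E n <= (expR (a n * b))%:E)%E].
Proof.
move=> [z0 [b0 Ib0]].
(* The supremum of [V] is [sup_z (z - I z)]; real [b > I z] keep the set inside the reals when [I z]
   is infinite. *)
pose V := [set s | exists z b, (I z < b%:E)%E /\ s = z - b].
have V0 : V !=set0 by exists (z0 - b0), z0, b0.
have ubV : ubound V (C1 + 1).
  move=> _ [z [b [Ib ->]]].
  have [n /= _ nP] := exp_moment_lower ltr01 Ib.
  have := le_trans (nP n (leqnn n)) (mom1 n).
  by rewrite lee_fin ler_expR ler_pM2l//; lra.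
have sV : has_sup V by split => //; exists (C1 + 1).
pose S := sup V.
have SI z : (z%:E <= S%:E + I z)%E.
  case Iz : (I z) (I0 z) => [r| |] // _; last by rewrite addey// leey.
  rewrite -EFinD lee_fin; apply/ler_addgt0Pr => e e0.
  suff : z - (r + e) <= S by lra.
  apply: sup_upper_bound => //; exists z, (r + e); split => //.
  by rewrite Iz lte_fin ltrDl.
exists S; split => //.
- move=> S' S'I; apply: ge_sup => // _ [z [b [Ib ->]]].
  have := S'I z; case Iz : (I z) (I0 z) Ib => [r| |] //.
  by rewrite lte_fin => _ rb; rewrite -EFinD lee_fin; lra.
- move=> b bS; have Sb : 0 < S - b by rewrite subr_gt0.
  have [_ [z [b' [Ib' ->]]]] := sup_adherent Sb sV; rewrite -/S => lt.
  have e0 : 0 < z - b' - b by move: lt; lra.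
  apply: filterS (exp_moment_lower e0 Ib') => n; apply: le_trans.
  by rewrite lee_fin ler_expR ler_pM2l//; lra.
(* Each of the [N + 2] terms of the splitting will be at most [exp (a (S + 2 e))]: on a cell with
   left end [y] the integrand costs [y + e] and the probability gains [y - S - e], while [M] is
   chosen to make [- M] and [C2 - M] at most [S]. The remaining [2 e] up to [b] pays for the number
   of terms. *)
- move=> b Sb; pose e := (b - S) / 4.
  have e0 : 0 < e by rewrite /e; lra.
  pose M := `|S| + `|C2 - S| + 1.
  have M0 : 0 < M by rewrite /M ltr_wpDl// addr_ge0.
  have MS : - M <= S by rewrite /M; have := ler_norm (- S); rewrite normrN; have := normr_ge0 (C2 - S); lra.
  have MC : C2 - M <= S by rewrite /M; have := ler_norm (C2 - S); have := normr_ge0 S; lra.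
  pose N := (Num.truncn (2 * M / e)).+1.
  have NM : 2 * M <= N%:R * e.
    by rewrite -ler_pdivrMr// ltW// truncnS_gt.
  have cells : \forall n \near \oo, forall j : 'I_N,
      (P (Y n @^-1` `[(- M + j%:R * e)%R, (- M + j.+1%:R * e)%R]) <=
         (expR (- (a n * (- M + j%:R * e - S - e))))%:E)%E.
    apply: filter_forall => j; apply: (@upper _ _ (- M + j%:R * e - S)); last by lra.
    move=> z /andP[zj _]; have := SI z; case: (I z) (I0 z) => [r| |] //; last by move=> _ _; rewrite leey.
    by move=> _; rewrite -EFinD !lee_fin; lra.
  (* From here on [N + 2 <= 2 e a n <= exp (2 e a n)]. *)
  have an1 : \forall n \near \oo, N.+2%:R / (2 * e) <= a n.
    by move/cvgryPge : ay; apply.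
  near=> n.
  have cn : forall j : 'I_N, (P (Y n @^-1` `[(- M + j%:R * e)%R, (- M + j.+1%:R * e)%R]) <=
         (expR (- (a n * (- M + j%:R * e - S - e))))%:E)%E by near: n.
  have ann : N.+2%:R / (2 * e) <= a n by near: n.
  apply: le_trans (exp_moment_split n M0 e0 NM) _.
  pose B := expR (a n * (S + 2 * e)).
  have B0 : 0 < B by exact: expR_gt0.
  apply: (@le_trans _ _ (B%:E + (B%:E + \sum_(j < N) B%:E))%E).
    apply: leeD; last apply: leeD.
    - by rewrite lee_fin ler_expR -mulrN ler_pM2l//; lra.
    - by rewrite -EFinM -expRD lee_fin ler_expR -mulrN -mulrDr ler_pM2l//; lra.
    - apply: lee_sum => j _.
      apply: (@le_trans _ _ ((expR (a n * (- M + j.+1%:R * e)))%:E *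
         (expR (- (a n * (- M + j%:R * e - S - e))))%:E)%E).
        by rewrite lee_pmul2l ?lte_fin ?expR_gt0.
      rewrite -EFinM -expRD lee_fin ler_expR -mulrN -mulrDr ler_pM2l//.
      by rewrite -natr1; lra.
  rewrite sumEFin -!EFinD lee_fin sumr_const card_ord.
  have -> : B + (B + B *+ N) = N.+2%:R * B by rewrite -!mulrS mulr_natl.
  have -> : expR (a n * b) = expR (a n * (2 * e)) * B.
    by rewrite /B -expRD -mulrDr; congr (expR (_ * _)); rewrite /e; field.
  rewrite ler_pM2r//; apply: (@le_trans _ _ (a n * (2 * e))).
    by rewrite -ler_pdivrMr// mulr_gt0.
  by apply: le_trans (expR_ge1Dx _); rewrite lerDr.
Unshelve. all: by end_near. Qed.

End varadhan.

(** * Finite-dimensional rate functions *)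

Section finite_dimensional.
Context {R : realType}.

Lemma continuous_sumR (S : topologicalType) (J : Type) (s : seq J) (F : J -> S -> R) :
  (forall i, continuous (F i)) -> continuous (fun x => \sum_(i <- s) F i x).
Proof.
move=> cF; elim: s => [|i s IH] x.
  by under eq_fun do rewrite big_nil; exact: cst_continuous.
under eq_fun do rewrite big_cons.
exact: (@continuousD _ _ _ (F i) (fun x => \sum_(i <- s) F i x) x (cF i x) (IH x)).
Qed.

Lemma rV_ballP m (x y : 'rV[R]_m) (e : R) : 0 < e ->
  ball x e y <-> forall i, `|x 0 i - y 0 i| < e.
Proof.
move=> e0; split=> [[_ xy] i|xy]; first exact: (xy 0 i).
by split => // i j; rewrite (ord1 i); exact: xy.
Qed.

Lemma rV_continuous (S : topologicalType) m (g : S -> 'rV[R]_m) :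
  (forall i, continuous (fun x => g x 0 i)) -> continuous g.
Proof.
move=> cg x; apply/cvg_ballP => e e0.
have : \forall y \near x, forall i, `|g x 0 i - g y 0 i| < e.
  by apply: filter_forall => i; exact: (@cvgr_dist_lt _ _ _ (nbhs x) _ _ _ (cg i x) e e0).
by apply: filterS => y; case: (rV_ballP (g x) (g y) e0).
Qed.

Lemma coord0_continuous m (i : 'I_m) : continuous (fun y : 'rV[R]_m => y 0 i).
Proof. exact: coord_continuous. Qed.

Lemma linear_form_continuous m (lam : 'I_m -> R) :
  continuous (fun y : 'rV[R]_m => \sum_i lam i * y 0 i).
Proof.
apply: continuous_sumR => i y.
by apply: continuousM; [exact: cst_continuous|exact: coord0_continuous].
Qed.

Lemma dist_continuous (S : topologicalType) m (g : S -> 'rV[R]_m) (z : 'rV[R]_m) :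
  continuous g -> continuous (fun y => `|g y - z|).
Proof.
move=> cg y; apply: (@continuous_comp _ _ _ (fun y => g y - z) Num.norm).
  by apply: continuousB; [exact: cg|exact: cst_continuous].
exact: norm_continuous.
Qed.

Lemma open_dist_lt (S : topologicalType) m (g : S -> 'rV[R]_m) z (e : R) :
  continuous g -> open [set y | `|g y - z| < e].
Proof.
move=> cg0; have cg := @dist_continuous S m g z cg0; apply: (@open_comp _ _ (fun y => `|g y - z|) [set t | t < e]).
  by move=> y _; exact: cg.
exact: open_lt.
Qed.

Lemma open_dist_gt (S : topologicalType) m (g : S -> 'rV[R]_m) z (e : R) :
  continuous g -> open [set y | e < `|g y - z| ].
Proof.
move=> cg0; have cg := @dist_continuous S m g z cg0; apply: (@open_comp _ _ (fun y => `|g y - z|) [set t | e < t]).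
  by move=> y _; exact: cg.
exact: open_gt.
Qed.

Lemma lsc_open m (I : 'rV[R]_m -> \bar R) (b : R) :
  good_rate (@open _) I -> open [set y | (b%:E < I y)%E].
Proof.
move=> [_ /(_ b) + _]; congr open; apply/seteqP; split => y /=.
  by move=> h; rewrite ltNge; exact/negP.
by rewrite ltNge => /negP.
Qed.

Lemma good_rate_bounded m (I : 'rV[R]_m -> \bar R) (b : R) :
  good_rate (@open _) I -> exists c : R, forall y, (I y <= b%:E)%E -> `|y| < c.
Proof.
move=> [_ _ /(_ b) cI].
have [||//|k kP] := compact_wrt_nested (U := fun k => [set y | `|y - 0| < k%:R]) cI.
- by move=> k; apply: (@open_dist_lt _ _ id) => x; exact: cvg_id.
- by move=> j k jk y /= /lt_le_trans; apply; rewrite ler_nat.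
- move=> y _; exists (Num.truncn `|y|).+1 => //=; rewrite subr0.
  exact: truncnS_gt.
- by exists k%:R => y /kP /=; rewrite subr0.
Qed.

(** * Two LDPs related by a continuous map *)

Section contraction.
Context {d : measure_display} {Om : measurableType d}.
Variables (P : probability Om R) (a : nat -> R).
Hypothesis a0 : forall n, 0 < a n.
Context {m m' : nat}.
Variables (X : nat -> Om -> 'rV[R]_m) (Y : nat -> Om -> 'rV[R]_m').
Variables (I : 'rV[R]_m -> \bar R) (J : 'rV[R]_m' -> \bar R).
Hypotheses (mX : forall n U, open U -> measurable (X n @^-1` U)).
Hypotheses (mY : forall n U, open U -> measurable (Y n @^-1` U)).
Hypotheses (lX : LDP P (@open _) X a I) (lY : LDP P (@open _) Y a J).
Variables (g : 'rV[R]_m -> 'rV[R]_m') (cg : continuous g).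
Hypothesis YgX : forall n w, Y n w = g (X n w).

(** The event [|Y - z| < e] is contained in [|g X - z| <= e], so the lower bound for [Y] forces a
    small value of [I] on the latter set. *)
Lemma LDP_preimage_approx z (e b : R) : 0 < e -> (J z < b%:E)%E ->
  exists2 y, `|g y - z| <= e & (I y < b%:E)%E.
Proof.
move=> e0 Jb; have cid : continuous (@id 'rV[R]_m') by move=> ?; exact: cvg_id.
have oC : open (~` [set y | `|g y - z| <= e]).
  rewrite (_ : ~` _ = [set y | e < `|g y - z| ]); first exact: open_dist_gt.
  by apply/seteqP; split => y /=; rewrite ltNge => /negP.
apply: (@LDP_compare _ _ _ _ _ a0 _ _ _ _ Y X J I [set z' | `|z' - z| < e]
  [set y | `|g y - z| <= e] z b lY lX) => //.
- exact: (open_dist_lt z e cid).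
- by move=> n; apply: mY; exact: (open_dist_lt z e cid).
- by move=> n; rewrite -[X in measurable X]setCK; apply: measurableC; exact: (mX n oC).
- by move=> n w /=; rewrite YgX => /ltW.
- by rewrite /= subrr normr0.
Qed.

(** The comparison now runs from [X] to [Y] and produces a point near [g y] with small [J]; lower
    semicontinuity of [J] at [g y] excludes it. Halving the radius keeps the closed ball inside the
    neighbourhood. *)
Lemma LDP_image_le y : good_rate (@open _) J -> (J (g y) <= I y)%E.
Proof.
move=> gJ; rewrite leNgt; apply/negP => /ereal_between[b [Ib bJ]].
have cid : continuous (@id 'rV[R]_m') by move=> ?; exact: cvg_id.
have : nbhs (g y) [set z | (b%:E < J z)%E].
  by apply: open_nbhs_nbhs; split => //; exact: lsc_open.
move=> /nbhs_ballP[e /= e0]; rewrite -ball_normE => eJ.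
have oC : open (~` [set z | `|z - g y| <= e / 2]).
  rewrite (_ : ~` _ = [set z | e / 2 < `|z - g y| ]); first exact: (open_dist_gt _ _ cid).
  by apply/seteqP; split => z /=; rewrite ltNge => /negP.
have [||||||//|z zg Jb] := @LDP_compare _ _ _ _ _ a0 _ _ _ _ X Y I J
  [set y' | `|g y' - g y| < e / 2] [set z | `|z - g y| <= e / 2] y b lX lY.
- exact: (open_dist_lt _ _ cg).
- exact: oC.
- by move=> n; apply: mX; exact: (open_dist_lt _ _ cg).
- by move=> n; rewrite -[X in measurable X]setCK; apply: measurableC; exact: (mY n oC).
- by move=> n w /=; rewrite YgX => /ltW.
- by rewrite /= subrr normr0 divr_gt0.
have : (b%:E < J z)%E.
  apply: eJ; rewrite /ball_ /= distrC; apply: (le_lt_trans zg); lra.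
by move=> /(lt_trans Jb); rewrite ltxx.
Qed.

End contraction.

(** * Affine minorants by quadratic penalisation *)

Section moreau.
Context {m : nat}.
Variable I : 'rV[R]_m -> \bar R.
Hypothesis gI : good_rate (@open _) I.

Let q (y0 y : 'rV[R]_m) := \sum_i (y 0 i - y0 0 i) ^+ 2.

Let q_ge0 y0 y : 0 <= q y0 y.
Proof. by apply: sumr_ge0 => i _; exact: sqr_ge0. Qed.

Let q_cont y0 : continuous (q y0).
Proof.
apply: continuous_sumR => i y.
have ci : continuous (fun y : 'rV[R]_m => y 0 i - y0 0 i).
  by move=> z; apply: continuousB; [exact: coord0_continuous|exact: cst_continuous].
exact: (@continuousM _ _ (fun y : 'rV[R]_m => y 0 i - y0 0 i) _ y (ci y) (ci y)).
Qed.

(** An excess over [b] is shared between strict lower bounds for [I] and for the penalty, both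
    stable near the point. Level sets are compact as closed subsets of those of [I]. *)
Lemma good_rate_add_quadratic (k : R) y0 : 0 <= k ->
  good_rate (@open _) (fun y => I y + (k * q y0 y)%:E)%E.
Proof.
move=> k0; have kq0 y : 0 <= k * q y0 y by rewrite mulr_ge0.
have I0 y : (0 <= I y)%E by case: gI.
have kqc : continuous (fun y => k * q y0 y).
  by move=> y; apply: continuousM; [exact: cst_continuous|exact: q_cont].
have cl (b : R) : open (~` [set y | (I y + (k * q y0 y)%:E <= b%:E)%E]).
  rewrite openE => y /= /negP; rewrite -ltNge => by_.
  have [c [cI bc]] : exists c : R, (c%:E < I y)%E /\ b < c + k * q y0 y.
    case Iy : (I y) (I0 y) by_ => [r| |] // _.
      rewrite -EFinD lte_fin => br; exists (r - (r + k * q y0 y - b) / 2).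
      by rewrite lte_fin; split; lra.
    by move=> _; exists (b - k * q y0 y + 1); rewrite ltry; split => //; lra.
  have n1 : nbhs y [set y | (c%:E < I y)%E].
    by apply: open_nbhs_nbhs; split => //; exact: lsc_open.
  have n2 : nbhs y [set y | b - c < k * q y0 y].
    apply: open_nbhs_nbhs; split; last by rewrite /=; lra.
    apply: (@open_comp _ _ (fun y => k * q y0 y) [set t | b - c < t]); last exact: open_gt.
    by move=> ? _; exact: kqc.
  apply: filterS (filterI n1 n2) => z [/= Iz qz].
  apply/negP; rewrite -ltNge; case: (I z) (I0 z) Iz => [r| |] // _.
    by rewrite -EFinD !lte_fin; move: qz; lra.
  by move=> _; rewrite addye// ltry.
split => [y|//|b]; first by rewrite adde_ge0// lee_fin.
have [_ _ /(_ b) cI] := gI.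
apply: (compact_wrt_sub cI) => [|y /=]; first exact: cl.
by apply: le_trans; rewrite leeDl// lee_fin.
Qed.

(* The point [p] minimises [I + k |. - y0|^2]; the affine minorant is the
   first-order optimality condition there, so no separation theorem is needed. *)
Lemma convex_affine_minorant (y0 : 'rV[R]_m) (c : R) : econvex I ->
  (exists y, (I y < +oo)%E) -> (c%:E < I y0)%E ->
  exists lam : 'I_m -> R,
    forall y : 'rV[R]_m, ((c + (\sum_i lam i * y 0 i - \sum_i lam i * y0 0 i))%R%:E <= I y)%E.
Proof.
move=> cvxI [y1 Iy1] cI0.
have I0 y : (0 <= I y)%E by case: gI.
have [k k0 [p pmin cp]] : exists2 k : R, 0 <= k & exists2 p,
    (forall y, I p + (k * q y0 p)%:E <= I y + (k * q y0 y)%:E)%E &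
    (c%:E <= I p + (k * q y0 p)%:E)%E.
  have : nbhs y0 [set y | (c%:E < I y)%E].
    by apply: open_nbhs_nbhs; split => //; exact: lsc_open.
  move=> /nbhs_ballP[r /= r0 rI].
  (* Within distance [r] of [y0] the rate itself exceeds [c]; with this [k] the penalty alone
     reaches [c] beyond it. So the minimal value is at least [c]. *)
  pose k := `|c| / r ^+ 2; have k0 : 0 <= k by rewrite divr_ge0// sqr_ge0.
  have [|p pmin] := good_rate_min (good_rate_add_quadratic y0 k0).
    by exists y1; rewrite lte_add_pinfty// ltry.
  exists k => //; exists p => //; rewrite leNgt; apply/negP => pc.
  have Ipc : (I p < c%:E)%E.
    by apply: le_lt_trans pc; rewrite leeDl// lee_fin mulr_ge0.
  have c0 : 0 <= c by rewrite -lee_fin (le_trans (I0 p))// ltW.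
  have kqc : k * q y0 p < c.
    by rewrite -lte_fin; apply: le_lt_trans pc; rewrite leeDr.
  suff : (c%:E < I p)%E by move=> /(lt_trans Ipc); rewrite ltxx.
  apply: rI; apply/(rV_ballP _ _ r0) => i; rewrite distrC ltNge; apply/negP => ri.
  move: kqc; apply/negP; rewrite -leNgt.
  have r2 : r ^+ 2 <= q y0 p.
    apply: (@le_trans _ _ ((p 0 i - y0 0 i) ^+ 2)).
      by rewrite -(ger0_norm (sqr_ge0 (_ - _))) normrX ler_pXn2r ?nnegrE// ltW.
    by rewrite /q (bigD1 i)//= lerDl; apply: sumr_ge0 => j _; exact: sqr_ge0.
  rewrite /k (ger0_norm c0) mulrAC ler_pdivlMr ?exprn_gt0//.
  by rewrite ler_wpM2l.
have Ip : (I p < +oo)%E.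
  have : (I p + (k * q y0 p)%:E < +oo)%E.
    by apply: (le_lt_trans (pmin y1)); rewrite lte_add_pinfty// ltry.
  by apply: le_lt_trans; rewrite leeDl// lee_fin mulr_ge0.
case Ipr : (I p) (I0 p) Ip => [r| |] // _ _.
(* The slope is minus the gradient at [p] of the penalty. *)
exists (fun i => 2 * k * (y0 0 i - p 0 i)) => y.
case Iys : (I y) (I0 y) => [s| |] // _; last by rewrite leey.
rewrite lee_fin.
pose B := \sum_i (p 0 i - y0 0 i) * (y 0 i - p 0 i).
pose Q := \sum_i (y 0 i - p 0 i) ^+ 2.
have Q0 : 0 <= Q by apply: sumr_ge0 => i _; exact: sqr_ge0.
have -> : \sum_i 2 * k * (y0 0 i - p 0 i) * y 0 i -
    \sum_i 2 * k * (y0 0 i - p 0 i) * y0 0 i = - (2 * k * B) - 2 * k * q y0 p.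
  rewrite /B /q !mulr_sumr -!sumrN -!big_split/=.
  by apply: eq_bigr => i _; ring.
(* Minimality of [p] is tested at the point of parameter [t] on the segment towards [y]; after
   convexity, everything left is divisible by [t]. Small [t] then removes the term in [Q]. *)
have step t : 0 < t <= 1 -> 0 <= s - r + 2 * k * B + k * t * Q.
  move=> /andP[t0 t1]; have t01 : 0 <= t <= 1 by rewrite ltW.
  have qt : q y0 (t *: y + (1 - t) *: p) = q y0 p + 2 * t * B + t ^+ 2 * Q.
    rewrite /q /B /Q !mulr_sumr -!big_split/=.
    by apply: eq_bigr => i _; rewrite !mxE; ring.
  have := le_trans (pmin (t *: y + (1 - t) *: p)) (leeD (cvxI y p t t01) (lexx _)).
  rewrite Ipr Iys qt -!EFinM -!EFinD lee_fin => h.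
  have : 0 <= t * (s - r + 2 * k * B + k * t * Q) by move: h; rewrite expr2; lra.
  by rewrite pmulr_rge0.
have sr : 0 <= s - r + 2 * k * B.
  apply/ler_addgt0Pr => e e0.
  have kQ : 0 <= k * Q by rewrite mulr_ge0.
  pose t := Num.min 1 (e / (k * Q + 1)).
  have t0 : 0 < t by rewrite lt_min ltr01 divr_gt0// ltr_wpDl.
  have t1 : t <= 1 by rewrite ge_min lexx.
  have te : k * t * Q <= e.
    have : t <= e / (k * Q + 1) by rewrite ge_min lexx orbT.
    rewrite ler_pdivlMr ?ltr_wpDl//; move: t0; nra.
  have t01 : 0 < t <= 1 by rewrite t0.
  have := step t t01; move: te; lra.
have kq : 0 <= k * q y0 p by rewrite mulr_ge0.
by move: cp; rewrite Ipr -EFinD lee_fin; move: sr kq; lra.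
Qed.

End moreau.
End finite_dimensional.

(** * The vague topology and the projective limit *)

Section vague_topology.
Context {R : realType} {T : ptopologicalType}.
Implicit Types (f : T -> R) (xi : radon R T).

Local Notation ev fs xi := (\row_i rint xi (fs i)).

Lemma vague_open_preimage m (fs : 'I_m -> T -> R) (V : set 'rV[R]_m) :
  (forall i, Cc (fs i)) -> open V -> vague_open [set xi | V (ev fs xi)].
Proof.
move=> Cfs oV xi /= Vxi.
have /nbhs_ballP[e /= e0 eV] : nbhs (ev fs xi) V by apply: open_nbhs_nbhs.
exists m, fs, e; split => // eta /= etae; apply: eV.
by apply/(rV_ballP _ _ e0) => i; rewrite !mxE distrC.
Qed.

Lemma vague_open_preimage1 f (V : set R) :
  Cc f -> open V -> vague_open [set xi | V (rint xi f)].
Proof.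
move=> Cf oV xi /= Vxi.
have /nbhs_ballP[e /= e0 eV] : nbhs (rint xi f) V by apply: open_nbhs_nbhs.
exists 1%N, (fun=> f), e; split => // eta /= etae; apply: eV.
by rewrite /ball /= distrC; exact: (etae ord0).
Qed.

Lemma ultra_bounded_cvg (S : Type) (U : set_system S) (h : S -> R) (c : R) :
  UltraFilter U -> U [set x | `|h x| <= c] -> exists l : R, h x @[x --> U] --> l.
Proof.
move=> UU Uc.
have [l [_ cl]] : `[- c, c]%classic `&` cluster (h @ U) !=set0.
  apply: (@segment_compact R (- c) c) => /=.
  by apply: filterS Uc => x /=; rewrite in_itv/= ler_norml.
exists l; apply/cvg_ballP => e e0.
have [//|nU] := in_ultra_setVsetC (h @^-1` ball l e) UU.
have [y [/= nby lby]] := cl (~` ball l e) (ball l e) nU (nbhsx_ballx l e e0).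
by case: nby.
Qed.

Section ultralimits.
Variables (Th : hausdorff_space T) (Tl : locally_compact [set: T]).
Hypothesis Ts : @second_countable T.

Lemma vague_ultralimit (U : set_system (radon R T)) : UltraFilter U ->
  (forall f, Cc f -> exists c : R, U [set xi | `|rint xi f| <= c]) ->
  exists xi0, forall f, Cc f -> rint xi f @[xi --> U] --> rint xi0 f.
Proof.
move=> UU bU.
have /choice[L LP] f : exists l : R, Cc f -> rint xi f @[xi --> U] --> l.
  have [Cf|nCf] := pselect (Cc f); last by exists 0.
  by have [c /(ultra_bounded_cvg UU)[l hl]] := bU f Cf; exists l.
have pU : ProperFilter U := @ultra_proper _ _ UU.
have uniq (h : radon R T -> R) (l l' : R) : h xi @[xi --> U] --> l ->
    h xi @[xi --> U] --> l' -> l = l'.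
  by apply: cvg_unique; exact: norm_hausdorff.
have [|xi0 xi0L] := riesz_representation Th Tl Ts (L := L); last first.
  by exists xi0 => f Cf; rewrite xi0L//; exact: LP.
split=> [f g Cf Cg|c f Cf|f Cf f0].
- apply: (uniq (fun xi => rint xi (fun x => f x + g x))); first exact/LP/CcD.
  under eq_fun do rewrite (pfD (rint_pf _))//.
  by apply: cvgD; exact: LP.
- apply: (uniq (fun xi => rint xi (fun x => c * f x))); first exact/LP/CcZ.
  under eq_fun do rewrite (pfZ (rint_pf _))//.
  by apply: cvgM; [exact: cvg_cst|exact: LP].
- apply: (@closed_cvg _ _ U _ (fun xi => rint xi f) _ (@closed_ge R 0) _ _ (LP f Cf)).
  by apply: nearW => xi; exact: (pf_ge0 (rint_pf xi) Cf f0).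
Qed.

Lemma vague_nbhs_ultralimit (U : set_system (radon R T)) xi0 (G : set (radon R T)) :
  Filter U -> (forall f, Cc f -> rint xi f @[xi --> U] --> rint xi0 f) ->
  vague_open G -> G xi0 -> U G.
Proof.
move=> FU lim oG /oG[m [fs [e [Cfs e0 eG]]]].
apply: filterS eG _; apply: filter_forall => i.
have := @cvgr_dist_lt _ _ _ U FU _ _ (lim _ (Cfs i)) e e0.
by apply: filterS => xi /=; rewrite distrC.
Qed.

End ultralimits.

(** * Goodness of the supremum rate and the LDP for the measures *)

Section projective_limit.
Variables (Th : hausdorff_space T) (Tl : locally_compact [set: T]).
Hypothesis Ts : @second_countable T.
Context {d : measure_display} {Om : measurableType d} (P : probability Om R).
Variables (a : nat -> R) (X : nat -> Om -> radon R T).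
Variable Ifam : forall m : nat, ('I_m -> T -> R) -> 'rV[R]_m -> \bar R.
Hypothesis a0 : forall n, 0 < a n.
Hypothesis mX : forall n (G : set (radon R T)), vague_open G -> measurable (X n @^-1` G).
Hypothesis ldpI : forall (m : nat) (fs : 'I_m -> T -> R), (0 < m)%N ->
  (forall i, Cc (fs i)) -> good_rate (@open _) (Ifam fs) /\
  LDP P (@open _) (fun n w => \row_i rint (X n w) (fs i)) a (Ifam fs).

Let mXev m (fs : 'I_m -> T -> R) n (V : set 'rV[R]_m) : (forall i, Cc (fs i)) ->
  open V -> measurable ((fun w => ev fs (X n w)) @^-1` V).
Proof. by move=> Cfs oV; exact: (mX n (vague_open_preimage Cfs oV)). Qed.

Lemma measurable_rint n f : Cc f -> measurable_fun setT (fun w => rint (X n w) f).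
Proof.
move=> Cf; apply: (measurability _ (RGenOpens.measurableE R)).
move=> _ [_ [b [c ->] <-]]; rewrite setTI.
exact: (mX n (vague_open_preimage1 Cf (interval_open _ _))).
Qed.

Lemma rate_image_le m m' (fs : 'I_m -> T -> R) (fs' : 'I_m' -> T -> R)
    (g : 'rV[R]_m -> 'rV[R]_m') y : (0 < m)%N -> (0 < m')%N ->
  (forall i, Cc (fs i)) -> (forall i, Cc (fs' i)) -> continuous g ->
  (forall xi, ev fs' xi = g (ev fs xi)) -> (Ifam fs' (g y) <= Ifam fs y)%E.
Proof.
move=> m0 m0' Cfs Cfs' cg fsg.
have [gI lI] := ldpI m0 Cfs; have [gI' lI'] := ldpI m0' Cfs'.
exact: (LDP_image_le a0 (fun n V => @mXev m fs n V Cfs)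
  (fun n V => @mXev m' fs' n V Cfs') lI lI' cg (fun n w => fsg (X n w)) y gI').
Qed.

Lemma rate_preimage_approx m m' (fs : 'I_m -> T -> R) (fs' : 'I_m' -> T -> R)
    (g : 'rV[R]_m -> 'rV[R]_m') z (e b : R) : (0 < m)%N -> (0 < m')%N ->
  (forall i, Cc (fs i)) -> (forall i, Cc (fs' i)) -> continuous g ->
  (forall xi, ev fs' xi = g (ev fs xi)) -> 0 < e -> (Ifam fs' z < b%:E)%E ->
  exists2 y, `|g y - z| <= e & (Ifam fs y < b%:E)%E.
Proof.
move=> m0 m0' Cfs Cfs' cg fsg.
have [gI lI] := ldpI m0 Cfs; have [gI' lI'] := ldpI m0' Cfs'.
exact: (LDP_preimage_approx a0 (fun n V => @mXev m fs n V Cfs)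
  (fun n V => @mXev m' fs' n V Cfs') lI lI' cg (fun n w => fsg (X n w))).
Qed.

Lemma rate_le_vague_rate m (fs : 'I_m -> T -> R) xi : (0 < m)%N ->
  (forall i, Cc (fs i)) -> (Ifam fs (ev fs xi) <= vague_rate Ifam xi)%E.
Proof. by move=> m0 Cfs; apply: ereal_sup_ubound; exists m, fs. Qed.

Lemma vague_rate_leP xi (al : \bar R) : (vague_rate Ifam xi <= al)%E <->
  forall m (fs : 'I_m -> T -> R), (0 < m)%N -> (forall i, Cc (fs i)) ->
    (Ifam fs (ev fs xi) <= al)%E.
Proof.
split=> [Ial m fs m0 Cfs|H]; first exact: le_trans (rate_le_vague_rate xi m0 Cfs) Ial.
by apply: ge_ereal_sup => _ [m [fs [m0 Cfs ->]]]; exact: H.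
Qed.

Lemma vague_rate_ge0 xi : (0 <= vague_rate Ifam xi)%E.
Proof.
have C0 (i : 'I_1) : Cc (fun _ : T => 0 : R) by exact: Cc0.
have [[I0 _ _] _] := ldpI (ltnSn 0) C0.
exact: le_trans (I0 _) (rate_le_vague_rate xi (ltnSn 0) C0).
Qed.

(** Lower semicontinuity along [U]. Only nearness to the level set is asked of the vectors:
    compactness uses it with the vectors themselves in the level set, the closed-set bound with
    genuine approximations. *)
Lemma rate_ultralimit_le (U : set_system (radon R T)) xi0 m (fs : 'I_m -> T -> R)
    (al : R) : ProperFilter U ->
  (forall f, Cc f -> rint xi f @[xi --> U] --> rint xi0 f) ->
  (0 < m)%N -> (forall i, Cc (fs i)) ->
  (forall e, 0 < e -> U [set xi | exists2 y, (Ifam fs y <= al%:E)%E &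
     forall i, `|rint xi (fs i) - y 0 i| < e]) ->
  (Ifam fs (ev fs xi0) <= al%:E)%E.
Proof.
move=> PU lim m0 Cfs Uy; rewrite leNgt; apply/negP => alI.
have [gI _] := ldpI m0 Cfs.
have : nbhs (ev fs xi0) [set y | (al%:E < Ifam fs y)%E].
  by apply: open_nbhs_nbhs; split => //; exact: lsc_open.
move=> /nbhs_ballP[e /= e0 eI]; have e20 : 0 < e / 2 by rewrite divr_gt0.
have U2 : U [set xi | forall i, `|rint xi0 (fs i) - rint xi (fs i)| < e / 2].
  apply: filter_forall => i.
  exact: (@cvgr_dist_lt _ _ _ U _ _ _ (lim _ (Cfs i)) (e / 2) e20).
have [xi [/= [y Iy xy] xi0xi]] := filter_ex (filterI (Uy _ e20) U2).
have : (al%:E < Ifam fs y)%E.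
  apply: eI; apply/(rV_ballP _ _ e0) => i; rewrite mxE.
  have -> : rint xi0 (fs i) - y 0 i = (rint xi0 (fs i) - rint xi (fs i)) +
     (rint xi (fs i) - y 0 i) by ring.
  by rewrite (le_lt_trans (ler_normD _ _))// [e]splitr ltrD.
by rewrite ltNge Iy.
Qed.

Let ev1 f xi : `|rint xi f| <= `|ev (fun _ : 'I_1 => f) xi|.
Proof.
rewrite leNgt; apply/negP => lt.
have n0 : 0 < `|rint xi f| by apply: le_lt_trans lt.
have : ball (0 : 'rV[R]_1) `|rint xi f| (ev (fun _ : 'I_1 => f) xi).
  by rewrite -ball_normE /ball_ /= sub0r normrN.
by move=> /(rV_ballP _ _ n0)/(_ ord0); rewrite !mxE sub0r normrN ltxx.
Qed.

(** Without a finite subcover, the sets [K] minus finite unions generate a proper filter. The limit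
    of an ultrafilter refining it lies in [K], hence in some [V] of the cover, yet the ultrafilter
    contains [K] minus [V]. *)
Lemma vague_rate_compact (al : R) :
  compact_wrt (@vague_open R T) [set xi | (vague_rate Ifam xi <= al%:E)%E].
Proof.
set K := [set xi | _]; move=> C Co KC; apply: contrapT => nofin.
pose F := filter_from [set D : set (set (radon R T)) | finite_set D /\ D `<=` C]
  (fun D => K `\` \bigcup_(V in D) V).
have FF : Filter F.
  apply: filter_from_filter; first by exists set0; split.
  move=> D1 D2 [f1 D1C] [f2 D2C]; exists (D1 `|` D2).
    by split; [rewrite finite_setU|move=> V [/D1C|/D2C]].
  move=> xi [Kxi nxi]; split; (split => // -[V DV Vxi]; apply: nxi; exists V => //).
    by left.
  by right.
have PF : ProperFilter F.
  apply: filter_from_proper => // D [fD DC]; apply: contrapT => noxi.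
  apply: nofin; exists D => //; split => // xi Kxi; apply: contrapT => nDxi.
  by apply: noxi; exists xi.
have [U [UU FU]] := ultraFilterLemma PF.
have UK : U K.
  by apply: FU; exists set0; [split|move=> xi []].
have pU : ProperFilter U := @ultra_proper _ _ UU.
have [f Cf|xi0 lim] := vague_ultralimit Th Tl Ts UU.
  have Cf1 (i : 'I_1) : Cc f by [].
  have [gI _] := ldpI (ltnSn 0) Cf1.
  have [c cP] := good_rate_bounded al gI; exists c; apply: filterS UK => xi Kxi /=.
  apply: le_trans (ev1 f xi) _; apply/ltW/cP.
  exact: le_trans (rate_le_vague_rate xi (ltnSn 0) Cf1) Kxi.
have Kxi0 : K xi0.
  apply/vague_rate_leP => m fs m0 Cfs.
  apply: (rate_ultralimit_le pU lim) => // e e0.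
  apply: filterS UK => xi Kxi; exists (ev fs xi).
    exact: le_trans (rate_le_vague_rate xi m0 Cfs) Kxi.
  by move=> i; rewrite mxE subrr normr0.
have [V CV Vxi0] := KC _ Kxi0.
have UV : U V by exact: (vague_nbhs_ultralimit _ lim (Co _ CV) Vxi0).
have UnV : U (K `\` \bigcup_(W in [set V]) W).
  by apply: FU; exists [set V] => //; split => // W ->.
have [xi [Vxi [_ nVxi]]] := filter_ex (filterI UV UnV).
by apply: nVxi; exists V.
Qed.

Lemma vague_rate_good : good_rate (@vague_open R T) (vague_rate Ifam).
Proof.
split; [exact: vague_rate_ge0| |exact: vague_rate_compact].
(* A supremum above [al] is already above [al] for one family, and this persists on a vague
   neighbourhood. *)
move=> al xi /= /negP; rewrite -ltNge => /ereal_sup_gt[_ [m [fs [m0 Cfs ->]]] alI].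
have [gI _] := ldpI m0 Cfs.
have [k [gs [e [Cgs e0 eP]]]] := vague_open_preimage Cfs (lsc_open (b := al) gI) alI.
exists k, gs, e; split => // eta /eP /= alIe.
by apply/negP; rewrite -ltNge (lt_le_trans alIe)//; exact: rate_le_vague_rate.
Qed.

Let concat m1 m2 (fs1 : 'I_m1 -> T -> R) (fs2 : 'I_m2 -> T -> R) :=
  fun i : 'I_(m1 + m2) => match fintype.split i with inl j => fs1 j | inr j => fs2 j end.

(* The sets of approximate solutions [B] are directed under concatenation of
   families, because rate functions decrease under coordinate projections; the
   limit of an ultrafilter containing them all replaces the projective limit. *)
Lemma closed_meets_level (A : set (radon R T)) (al : R) :
  vague_open (~` A) ->
  (forall m (fs : 'I_m -> T -> R) (e : R), (0 < m)%N -> (forall i, Cc (fs i)) ->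
     0 < e -> exists xi, A xi /\ exists2 y, (Ifam fs y <= al%:E)%E &
       forall i, `|rint xi (fs i) - y 0 i| < e) ->
  exists2 xi, A xi & (vague_rate Ifam xi <= al%:E)%E.
Proof.
move=> oA H.
pose D := [set q : {m : nat & 'I_m -> T -> R} * R |
  [/\ (0 < projT1 q.1)%N, forall i, Cc (projT2 q.1 i) & 0 < q.2]].
pose B (q : {m : nat & 'I_m -> T -> R} * R) := [set xi | A xi /\
  exists2 y, (Ifam (projT2 q.1) y <= al%:E)%E &
  forall i, `|rint xi (projT2 q.1 i) - y 0 i| < q.2].
have FF : Filter (filter_from D B).
  apply: filter_from_filter.
    by exists (existT _ 1%N (fun _ _ => 0), 1); split => //= _; exact: Cc0.
  move=> [[m1 fs1] e1] [[m2 fs2] e2] [/= m10 Cfs1 e10] [/= m20 Cfs2 e20].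
  have Cc12 i : Cc (concat fs1 fs2 i) by rewrite /concat; case: fintype.split.
  have m120 : (0 < m1 + m2)%N by rewrite addn_gt0 m10.
  exists (existT _ (m1 + m2)%N (concat fs1 fs2), Num.min e1 e2) => /=.
    by split => //=; rewrite lt_min e10.
  move=> xi [Axi [y /= Iy xy]].
  have fl j : concat fs1 fs2 (lshift m2 j) = fs1 j.
    by rewrite /concat (unsplitK (inl j)).
  have fr j : concat fs1 fs2 (rshift m1 j) = fs2 j.
    by rewrite /concat (unsplitK (inr j)).
  split; split => //=.
  - exists (\row_j y 0 (lshift m2 j)).
      apply: le_trans Iy; apply: (rate_image_le (g := fun y => \row_j y 0 (lshift m2 j))) => //.
        apply: rV_continuous => j; under eq_fun do rewrite mxE.
        exact: coord0_continuous.
      by move=> eta; apply/rowP => j; rewrite !mxE fl.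
    by move=> j; rewrite mxE -fl (lt_le_trans (xy _))// ge_min lexx.
  - exists (\row_j y 0 (rshift m1 j)).
      apply: le_trans Iy; apply: (rate_image_le (g := fun y => \row_j y 0 (rshift m1 j))) => //.
        apply: rV_continuous => j; under eq_fun do rewrite mxE.
        exact: coord0_continuous.
      by move=> eta; apply/rowP => j; rewrite !mxE fr.
    by move=> j; rewrite mxE -fr (lt_le_trans (xy _))// ge_min lexx orbT.
have PF : ProperFilter (filter_from D B).
  apply: filter_from_proper => // -[[m fs] e] [/= m0 Cfs e0].
  by have [xi [Axi xiy]] := H m fs e m0 Cfs e0; exists xi; split.
have [U [UU FU]] := ultraFilterLemma PF.
have pU : ProperFilter U := @ultra_proper _ _ UU.
have UB m (fs : 'I_m -> T -> R) e : (0 < m)%N -> (forall i, Cc (fs i)) -> 0 < e ->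
    U (B (existT _ m fs, e)).
  by move=> m0 Cfs e0; apply: FU; exists (existT _ m fs, e).
have [f Cf|xi0 lim] := vague_ultralimit Th Tl Ts UU.
  have Cf1 (i : 'I_1) : Cc f by [].
  have [gI _] := ldpI (ltnSn 0) Cf1.
  (* [c] bounds the level set of [I_f], and membership in [B] with tolerance 1 adds at most 1. *)
  have [c cP] := good_rate_bounded al gI; exists (c + 1).
  apply: filterS (UB 1%N (fun=> f) 1 (ltnSn 0) Cf1 ltr01) => xi [_ [y /= Iy xy]] /=.
  apply: le_trans (ev1 f xi) _.
  have yx : ball y 1 (ev (fun _ : 'I_1 => f) xi).
    by apply/(rV_ballP _ _ ltr01) => i; rewrite !mxE distrC; exact: xy.
  rewrite -ball_normE /ball_ /= in yx.
  have := ler_normB y (y - ev (fun _ : 'I_1 => f) xi).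
  by rewrite subKr; have := cP _ Iy; move: yx; lra.
exists xi0; last first.
  apply/vague_rate_leP => m fs m0 Cfs.
  apply: (rate_ultralimit_le pU lim) => // e e0.
  by apply: filterS (UB m fs e m0 Cfs e0) => xi [].
apply: contrapT => nA.
have UnA : U (~` A) by exact: (vague_nbhs_ultralimit _ lim oA nA).
have C0 (i : 'I_1) : Cc (fun _ : T => 0 : R) by exact: Cc0.
by have [xi [nAxi [Axi _]]] := filter_ex (filterI UnA (UB 1%N _ 1 (ltnSn 0) C0 ltr01)).
Qed.

Lemma vague_LDP : LDP P (@vague_open R T) X a (vague_rate Ifam).
Proof.
split=> [F oF|G oG]; last first.
  apply/log_lowerP => // b /ereal_inf_lt[_ [xi Gxi <-] Ib].
  have [m [fs [e [Cfs e0 eG]]]] := oG _ Gxi.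
  (* a zero function is appended because [m = 0] is allowed here *)
  pose fs' := concat fs (fun _ : 'I_1 => (fun=> 0)).
  have Cfs' i : Cc (fs' i).
    by rewrite /fs' /concat; case: fintype.split => // _; exact: Cc0.
  have fl j : fs' (lshift 1 j) = fs j by rewrite /fs' /concat (unsplitK (inl j)).
  have m0' : (0 < m + 1)%N by rewrite addn1.
  have [gI lI] := ldpI m0' Cfs'.
  have oV : open (ball (ev fs' xi) e) by exact: ball_open.
  have Iev : (Ifam fs' (ev fs' xi) < b%:E)%E.
    exact: le_lt_trans (rate_le_vague_rate xi m0' Cfs') Ib.
  have := LDP_lower a0 lI oV (ballxx _ e0) Iev.
  apply: filterS => n /le_trans; apply; apply: le_measure.
  - exact/mem_set/mXev.
  - exact/mem_set/mX.
  - move=> w /= /(rV_ballP _ _ e0) wball; apply: eG => i.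
    by have := wball (lshift 1 i); rewrite !mxE fl distrC.
apply/log_upperP => // b /ereal_between[al [bal]] alF; rewrite lte_fin in bal.
(* Otherwise every family would have points of [F] arbitrarily near its level set, and
   [closed_meets_level] would give a point of [F] with rate at most [al], against [al < inf_F I]. *)
have [m [fs [e [m0 Cfs e0 far]]]] : exists m (fs : 'I_m -> T -> R) e,
    [/\ (0 < m)%N, forall i, Cc (fs i), 0 < e & forall xi, F xi ->
      forall y, (Ifam fs y <= al%:E)%E -> ~ (forall i, `|rint xi (fs i) - y 0 i| < e)].
  apply: contrapT => no.
  have [||xi Fxi Ixi] := @closed_meets_level F al => //.
    move=> m fs e m0 Cfs e0; apply: contrapT => noxi; apply: no.
    exists m, fs, e; split => // xi Fxi y Iy xy; apply: noxi.
    by exists xi; split => //; exists y.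
  move: alF; apply/negP; rewrite -leNgt; apply: le_trans Ixi.
  by apply: ereal_inf_lbound; exists xi.
have [gI lI] := ldpI m0 Cfs.
pose N := \bigcup_(y in [set y | (Ifam fs y <= al%:E)%E]) ball y e.
have oN : open N by apply: bigcup_open => y _; exact: ball_open.
have NI y : (~` N) y -> (al%:E <= Ifam fs y)%E.
  move=> nNy; rewrite leNgt; apply/negP => Iy; apply: nNy.
  by exists y; [exact: ltW|exact: ballxx].
have oNN : open (~` ~` N) by rewrite setCK.
have := LDP_upper a0 lI oNN NI bal.
apply: filterS => n; apply: le_trans; apply: le_measure.
- by apply: mem_set; rewrite -[F]setCK; apply: measurableC; exact: mX.
- by apply: mem_set; apply: measurableC; exact: mXev.
- move=> w /= Fw [y /= Iy] /(rV_ballP _ _ e0) yw.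
  by apply: (far _ Fw y Iy) => i; have := yw i; rewrite mxE distrC.
Qed.

End projective_limit.
End vague_topology.

(** * Zeros and Legendre duality *)

Section zeros_and_convexity.
Context {R : realType} {T : ptopologicalType}.
Context {d : measure_display} {Om : measurableType d} (P : probability Om R).
Variables (a : nat -> R).
Hypothesis a0 : forall n, 0 < a n.

(** A rate at least [c] everywhere would make the probability of the whole space, which is 1, at
    most [exp (- a c / 2)]. *)
Lemma LDP_small_rate (S : Type) (opn : set S -> Prop) (X : nat -> Om -> S)
    (I : S -> \bar R) (c : R) : opn (~` setT) -> LDP P opn X a I -> 0 < c ->
  exists x, (I x < c%:E)%E.
Proof.
move=> oT lI c0; apply: contrapT => noc.
have cI x : setT x -> (c%:E <= I x)%E.
  by move=> _; rewrite leNgt; apply/negP => Ic; apply: noc; exists x.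
have c20 : c / 2 < c by lra.
have [n _ /(_ n (leqnn n))] := LDP_upper a0 lI oT cI c20.
rewrite /= preimage_setT probability_setT lee_fin -expR0 ler_expR oppr_ge0.
by rewrite pmulr_rle0// leNgt divr_gt0.
Qed.

Lemma LDP_zero (S : Type) (opn : set S -> Prop) (X : nat -> Om -> S)
    (I : S -> \bar R) : opn (~` setT) -> good_rate opn I -> LDP P opn X a I ->
  exists x, I x = 0%E.
Proof.
move=> oT gI lI; have [I0 _ _] := gI.
have [x1 Ix1] := LDP_small_rate oT lI ltr01.
have [|x xmin] := good_rate_min gI; first by exists x1; apply: lt_trans Ix1 (ltry _).
exists x; apply/eqP; rewrite eq_le I0 andbT leNgt; apply/negP.
move=> /ereal_between[c [c0 cI]]; rewrite lte_fin in c0.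
have [y Iy] := LDP_small_rate oT lI c0.
by have := lt_trans (le_lt_trans (xmin y) Iy) cI; rewrite ltxx.
Qed.

Lemma scaled_elog_cvg (p : nat -> \bar R) (l : R) : (forall n, (0 <= p n)%E) ->
  (forall b, b < l -> \forall n \near \oo, ((expR (a n * b))%:E <= p n)%E) ->
  (forall b, l < b -> \forall n \near \oo, (p n <= (expR (a n * b))%:E)%E) ->
  (((a n)^-1)%:E * elog (p n))%E @[n --> \oo] --> l%:E.
Proof.
move=> p0 lo up; apply/fine_cvgP.
have bnd e : 0 < e -> \forall n \near \oo,
    ((l - e)%:E <= ((a n)^-1)%:E * elog (p n) <= (l + e)%:E)%E.
  move=> e0; have n1 : l - e < l by lra.
  have n2 : l < l + e by lra.
  apply: filterS2 (lo _ n1) (up _ n2) => n h1 h2.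
  by rewrite scaled_elog_ge// scaled_elog_le// h1.
split.
  apply: filterS (bnd 1 ltr01) => n /andP[h1 h2].
  by rewrite fin_numE gt_eqF ?lt_eqF//; [exact: le_lt_trans h2 (ltry _)|
    exact: lt_le_trans (ltNyr _) h1].
apply/cvgrPdist_le => e e0; apply: filterS (bnd e e0) => n /=.
move: (((a n)^-1)%:E * elog (p n))%E => [r| |] /=.
- by rewrite !lee_fin ler_distlC.
- by rewrite leye_eq andbF.
- by [].
Qed.

Variables (Th : hausdorff_space T) (Tl : locally_compact [set: T]).
Hypothesis Ts : @second_countable T.
Variable X : nat -> Om -> radon R T.
Variable Ifam : forall m : nat, ('I_m -> T -> R) -> 'rV[R]_m -> \bar R.
Hypothesis ay : a n @[n --> \oo] --> +oo.
Hypothesis mX : forall n (G : set (radon R T)), vague_open G -> measurable (X n @^-1` G).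
Hypothesis ldpI : forall (m : nat) (fs : 'I_m -> T -> R), (0 < m)%N ->
  (forall i, Cc (fs i)) -> good_rate (@open _) (Ifam fs) /\
  LDP P (@open _) (fun n w => \row_i rint (X n w) (fs i)) a (Ifam fs).

Local Notation I1 f z := (Ifam (fun _ : 'I_1 => f) (\row_i z)).

(** A zero exists because a good rate attains its infimum, which an LDP forces to be 0. At a zero of
    the supremum each [I_f] vanishes too, so two zeros have equal integrals against every [f]. *)
Lemma vague_rate_unique_zero :
  (forall f : T -> R, Cc f -> exists y : 'rV[R]_1, Ifam (fun _ => f) y = 0%E /\
     forall z, Ifam (fun _ => f) z = 0%E -> z = y) ->
  exists xi : radon R T, vague_rate Ifam xi = 0%E /\
    forall eta, vague_rate Ifam eta = 0%E -> meq eta xi.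
Proof.
move=> uniq1.
have oT : vague_open (~` [set: radon R T]) by rewrite setCT => ?.
have [xi Ixi] := LDP_zero oT (vague_rate_good Th Tl Ts ldpI)
  (vague_LDP Th Tl Ts a0 mX ldpI).
exists xi; split => // eta Ieta; apply: radon_unique => // f Cf.
have [y [_ yP]] := uniq1 f Cf.
have Cf1 (i : 'I_1) : Cc f by [].
have [[I0 _ _] _] := ldpI (ltnSn 0) Cf1.
have val zeta : vague_rate Ifam zeta = 0%E -> \row_(i < 1) rint zeta f = y.
  move=> Iz; apply: yP; apply/eqP; rewrite eq_le I0 andbT -Iz.
  exact: (rate_le_vague_rate Ifam zeta (ltnSn 0) Cf1).
by have /rowP/(_ ord0) := etrans (val eta Ieta) (esym (val xi Ixi)); rewrite !mxE.
Qed.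

Lemma coord_row1 (y : 'rV[R]_1) : \row_i y 0 ord0 = y.
Proof. by apply/rowP => i; rewrite mxE (ord1 i). Qed.

Lemma coord0_preimage (V : set R) : open V -> open [set y : 'rV[R]_1 | V (y 0 ord0)].
Proof.
move=> oV; apply: (@open_comp _ _ (fun y : 'rV[R]_1 => y 0 ord0) V) => // y _.
exact: coord0_continuous.
Qed.

(** The last two clauses say that [S] is the supremum of [z - I_f z], in a form that avoids
    subtracting infinite values. *)
Lemma moment_generating_limit f (C1 C2 : R) : Cc f ->
  (forall n, (((a n)^-1)%:E * elog (\int[P]_w (expR (a n * rint (X n w) f))%:E) <= C1%:E)%E) ->
  (forall n, (((a n)^-1)%:E *
     elog (\int[P]_w (expR (a n * rint (X n w) (fun x => (2 * f x)%R)))%:E) <= C2%:E)%E) ->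
  exists S : R, [/\
    (((a n)^-1)%:E * elog (\int[P]_w (expR (a n * rint (X n w) f))%:E))%E
       @[n --> \oo] --> S%:E,
    forall z, (z%:E <= S%:E + I1 f z)%E &
    forall S' : R, (forall z, (z%:E <= S'%:E + I1 f z)%E) -> S <= S'].
Proof.
move=> Cf mom1 mom2.
have Cf1 (i : 'I_1) : Cc f by [].
have [gI lI] := ldpI (ltnSn 0) Cf1; have [I0 _ _] := gI.
have int0 (h : Om -> R) : (0 <= \int[P]_w (expR (h w))%:E)%E.
  by apply: integral_ge0 => w _; rewrite lee_fin expR_ge0.
have lower z e b : 0 < e -> (I1 f z < b%:E)%E -> \forall n \near \oo,
    ((expR (- (a n * b)))%:E <=
      P ((fun w => rint (X n w) f) @^-1` `](z - e)%R, (z + e)%R[))%E.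
  move=> e0 Ib.
  have oG : open [set y : 'rV[R]_1 | `]z - e, z + e[%classic (y 0 ord0)].
    exact: coord0_preimage (interval_open _ _).
  have Gz : [set y : 'rV[R]_1 | `]z - e, z + e[%classic (y 0 ord0)] (\row_i z).
    by rewrite /= mxE in_itv/= ltrBlDr !ltrDl e0.
  have := LDP_lower a0 lI oG Gz Ib.
  apply: filterS => n /le_trans; apply; rewrite le_eqVlt; apply/orP; left.
  by apply/eqP; congr (P _); apply/seteqP; split => w /=; rewrite mxE.
have upper z1 z2 c b : (forall z, z1 <= z <= z2 -> (c%:E <= I1 f z)%E) -> b < c ->
    \forall n \near \oo, (P ((fun w => rint (X n w) f) @^-1` `[z1, z2]) <=
      (expR (- (a n * b)))%:E)%E.
  move=> cI bc.
  have oC : open (~` [set y : 'rV[R]_1 | `[z1, z2]%classic (y 0 ord0)]).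
    have /coord0_preimage : open (~` `[z1, z2]%classic).
      by apply: closed_openC; exact: interval_closed.
    by [].
  have Cc' (y : 'rV[R]_1) : [set y : 'rV[R]_1 | `[z1, z2]%classic (y 0 ord0)] y ->
      (c%:E <= Ifam (fun _ => f) y)%E.
    by move=> /=; rewrite in_itv/= -{3}(coord_row1 y); exact: cI.
  have := LDP_upper a0 lI oC Cc' bc.
  apply: filterS => n; apply: le_trans; rewrite le_eqVlt; apply/orP; left.
  by apply/eqP; congr (P _); apply/seteqP; split => w /=; rewrite mxE.
have M1 n : (\int[P]_w (expR (a n * rint (X n w) f))%:E <= (expR (a n * C1))%:E)%E.
  by rewrite -scaled_elog_le.
have M2 n : (\int[P]_w (expR (a n * (2 * rint (X n w) f)))%:E <= (expR (a n * C2))%:E)%E.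
  have h := mom2 n; rewrite (scaled_elog_le _ (a0 n) (int0 _)) in h.
  apply: le_trans h; rewrite le_eqVlt; apply/orP; left; apply/eqP.
  apply: eq_integral => w _.
  by congr (expR (a n * _))%:E; apply: esym; exact: (pfZ (rint_pf (X n w)) 2 Cf).
have [|S [SI Smin lo up]] := varadhan_linear a0 ay (fun n => measurable_rint mX n Cf)
  (fun z => I0 _) lower upper M1 M2.
  have oT : open (~` [set: 'rV[R]_1]) by rewrite setCT; exact: open0.
  have [y Iy] := LDP_zero oT gI lI; exists (y 0 ord0), 1.
  by rewrite coord_row1 Iy lte_fin.
by exists S; split => //; exact: scaled_elog_cvg.
Qed.

Lemma vague_rate_legendre (phi : (T -> R) -> R) xi :
  (forall (m : nat) (fs : 'I_m -> T -> R), (0 < m)%N ->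
     (forall i, Cc (fs i)) -> econvex (Ifam fs)) ->
  (forall f, Cc f -> forall z, (z%:E <= (phi f)%:E + I1 f z)%E) ->
  (forall f, Cc f -> forall S' : R,
     (forall z, (z%:E <= S'%:E + I1 f z)%E) -> phi f <= S') ->
  vague_rate Ifam xi = ereal_sup [set (rint xi f - phi f)%:E | f in @Cc R T].
Proof.
move=> cvxI phiI phimin; apply/eqP; rewrite eq_le; apply/andP; split; last first.
  apply: ge_ereal_sup => _ [f Cf <-].
  have Cf1 (i : 'I_1) : Cc f by [].
  apply: le_trans (rate_le_vague_rate Ifam xi (ltnSn 0) Cf1).
  by rewrite EFinB leeBlDl// phiI.
apply/vague_rate_leP => m fs m0 Cfs; rewrite leNgt; apply/negP.
move=> /ereal_between[c [supc cI]]; move: supc; apply/negP; rewrite -leNgt.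
have [gI lI] := ldpI m0 Cfs.
have oT : open (~` [set: 'rV[R]_m]) by rewrite setCT; exact: open0.
have [y1 Iy1] := LDP_zero oT gI lI.
have [|lam lamP] := convex_affine_minorant gI (cvxI _ _ m0 Cfs) _ cI.
  by exists y1; rewrite Iy1 ltry.
pose f x := \sum_i lam i * fs i x.
have Cf : Cc f by apply: Cc_sum => i; exact: CcZ.
have Cf1 (i : 'I_1) : Cc f by [].
have rintf eta : rint eta f = \sum_i lam i * rint eta (fs i).
  rewrite (pf_sum (rint_pf eta) (index_enum _) (F := fun i x => lam i * fs i x)).
    by apply: eq_bigr => i _; rewrite (pfZ (rint_pf eta)).
  by move=> i; exact: CcZ.
apply: (@le_trans _ _ (rint xi f - phi f)%:E); last first.
  by apply: ereal_sup_ubound; exists f.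
(* The goal becomes [phi f <= xi f - c], and minimality of [phi f] reduces it to
   [z <= (xi f - c) + I_f z] for every real [z]. *)
rewrite lee_fin lerBrDr addrC -lerBrDr; apply: phimin => // z.
have [[I0 _ _] _] := ldpI (ltnSn 0) Cf1.
case Iz : (I1 f z) (I0 (\row_i z)) => [r| |] // _; last by rewrite addey// leey.
rewrite -EFinD lee_fin; apply/ler_addgt0Pr => e e0; have e20 : 0 < e / 2 by rewrite divr_gt0.
pose g (y : 'rV[R]_m) : 'rV[R]_1 := \row_(i < 1) \sum_j lam j * y 0 j.
have cg : continuous g.
  apply: rV_continuous => i; under eq_fun do rewrite mxE.
  exact: linear_form_continuous.
have Ib : (I1 f z < (r + e / 2)%:E)%E by rewrite Iz lte_fin ltrDl.
(* The minorant lives on vectors, so [z] is lifted to a vector [y]: one [e / 2] is spent on [g y]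
   missing [z], the other on the rate of [y] exceeding [I_f z]. *)
have [|y gyz Iy] := rate_preimage_approx a0 mX ldpI m0 (ltnSn 0) Cfs Cf1 cg _ e20 Ib.
  move=> eta; apply/rowP => i; rewrite !mxE rintf.
  by apply: eq_bigr => j _; rewrite mxE.
have gyz' : `|\sum_j lam j * y 0 j - z| <= e / 2.
  rewrite leNgt; apply/negP => lt.
  have n0 : 0 < `|\sum_j lam j * y 0 j - z| by apply: lt_trans lt.
  have : ball (0 : 'rV[R]_1) `|\sum_j lam j * y 0 j - z| (g y - \row_i z).
    by rewrite -ball_normE /ball_ /= sub0r normrN; exact: le_lt_trans lt.
  by move=> /(rV_ballP _ _ n0)/(_ ord0); rewrite !mxE sub0r normrN ltxx.
have := le_lt_trans (lamP y) Iy; rewrite lte_fin.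
have -> : \sum_i lam i * (\row_i rint xi (fs i)) 0 i = rint xi f.
  by rewrite rintf; apply: eq_bigr => i _; rewrite mxE.
by move: gyz'; rewrite ler_norml => /andP[]; lra.
Qed.

End zeros_and_convexity.

Theorem mainTheorem16 (R : realType) (Delta : ptopologicalType)
  (d : measure_display) (Om : measurableType d) (P : probability Om R)
  (a : nat -> R) (X : nat -> Om -> radon R Delta)
  (Ifam : forall m : nat, ('I_m -> Delta -> R) -> 'rV[R]_m -> \bar R) :
  hausdorff_space Delta ->
  locally_compact [set: Delta] ->
  @second_countable Delta ->
  (forall n, 0 < a n) ->
  a n @[n --> \oo] --> +oo ->
  (forall n (G : set (radon R Delta)), vague_open G -> measurable (X n @^-1` G)) ->
  (forall (m : nat) (fs : 'I_m -> Delta -> R), (0 < m)%N -> (forall i, Cc (fs i)) ->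
     good_rate (@open _) (Ifam m fs) /\
     LDP P (@open _) (fun n w => \row_i rint (X n w) (fs i)) a (Ifam m fs)) ->
  [/\ good_rate (@vague_open R Delta) (vague_rate Ifam),
      LDP P (@vague_open R Delta) X a (vague_rate Ifam),
      ((forall f : Delta -> R, Cc f ->
          exists y : 'rV[R]_1, Ifam 1%N (fun _ => f) y = 0%E /\
            forall z, Ifam 1%N (fun _ => f) z = 0%E -> z = y) ->
        exists xi : radon R Delta, vague_rate Ifam xi = 0%E /\
          forall eta, vague_rate Ifam eta = 0%E -> meq eta xi) &
      ((forall (m : nat) (fs : 'I_m -> Delta -> R), (0 < m)%N ->
          (forall i, Cc (fs i)) -> econvex (Ifam m fs)) ->
       (forall f : Delta -> R, Cc f -> exists C : R, forall n,
          (((a n)^-1)%:E * elog (\int[P]_w (expR (a n * rint (X n w) f))%:E) <= C%:E)%E) ->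
       exists phi : (Delta -> R) -> R,
         (forall f : Delta -> R, Cc f ->
            (((a n)^-1)%:E * elog (\int[P]_w (expR (a n * rint (X n w) f))%:E))%E
              @[n --> \oo] --> (phi f)%:E) /\
         (forall xi : radon R Delta,
            vague_rate Ifam xi = ereal_sup [set (rint xi f - phi f)%:E | f in @Cc R Delta]))].
Proof.
move=> Th Tl Ts a0 ay mX ldpI; split.
- exact: (vague_rate_good Th Tl Ts ldpI).
- exact: (vague_LDP Th Tl Ts a0 mX ldpI).
- exact: (vague_rate_unique_zero a0 Th Tl Ts mX ldpI).
move=> cvxI mom.
have /choice[phi phiP] (f : Delta -> R) : exists S : R, Cc f -> [/\
    (((a n)^-1)%:E * elog (\int[P]_w (expR (a n * rint (X n w) f))%:E))%E
       @[n --> \oo] --> S%:E,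
    forall z, (z%:E <= S%:E + Ifam 1%N (fun=> f) (\row_i z))%E &
    forall S' : R, (forall z, (z%:E <= S'%:E + Ifam 1%N (fun=> f) (\row_i z))%E) -> S <= S'].
  have [Cf|nCf] := pselect (Cc f); last by exists 0.
  have [C1 mom1] := mom f Cf; have [C2 mom2] := mom _ (CcZ 2 Cf).
  have [S SP] := moment_generating_limit a0 ay mX ldpI Cf mom1 mom2.
  by exists S.
exists phi; split=> [f /phiP[]//|xi].
apply: (vague_rate_legendre a0 mX ldpI) => // f Cf; by have [] := phiP f Cf.
Qed.
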